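(* Let $G$ be a countable group with identity $\mathrm{id}$, let $(\Omega,\mathcal A,\mathbb P)$ be a probability space and let $a(x,y):\Omega\to\mathbb C$, $x,y\in G$, be random variables such that (1) $a(x,y)=\overline{a(y,x)}$ for all $x,y\in G$ (pointwise on $\Omega$); (2) for each $z\in G$ the random vectors $(a(x,y))_{x,y\in G}$ and $(a(xz,yz))_{x,y\in G}$ are identically distributed, i.e. $\mathbb P\{(a(x,y))_{x,y\in F}\in E\}=\mathbb P\{(a(xz,yz))_{x,y\in F}\in E\}$ for all finite $F\subseteq G$ and all Borel sets $E\subseteq\mathbb C^{F\times F}$; (3) $\mathbb E\bigl[\bigl(\sum_{x\in G}|a(x,\mathrm{id})|\bigr)^2\bigr]<\infty$. For $f$ in the space $D_0$ of finitely supported functions on $G$ let $(\tilde A^{(\omega)}f)(x):=\sum_{y\in G}a^{(\omega)}(x,y)f(y)$, $x\in G$. Then there exists $\tilde\Omega\in\mathcal A$ with $\mathbb P(\tilde\Omega)=1$ such that for all $\omega\in\tilde\Omega$ the operator $\tilde A^{(\omega)}:D_0\to\ell^2(G)$ is (well defined and) essentially self-adjoint. Moreover, denoting by $\bar A^{(\omega)}$ the self-adjoint extension of $\tilde A^{(\omega)}$ for $\omega\in\tilde\Omega$ and setting $A^{(\omega)}:=\bar A^{(\omega)}$ if $\omega\in\tilde\Omega$ and $A^{(\omega)}:=\mathrm{Id}$ otherwise, the resolvents $\omega\mapsto(z-A^{(\omega)})^{-1}$, $z\in\mathbb C\setminus\mathbb R$, are strongly measurable.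
   Context: Strong measurability of $\omega\mapsto R^{(\omega)}$, with $R^{(\omega)}$ bounded operators on $\ell^2(G)$, means that $\omega\mapsto R^{(\omega)}\xi\in\ell^2(G)$ is measurable for every $\xi\in\ell^2(G)$. $D_0=\{f\in\ell^2(G)\mid|\operatorname{supp}f|<\infty\}$. *)

(* Defs.v *)
From HB Require Import structures.
From mathcomp Require Import all_boot all_order all_algebra.
From mathcomp Require Import finmap complex ring.
From mathcomp Require Import all_classical all_reals all_analysis.
From mathcomp.analysis.showcase Require summability.

Set Implicit Arguments.
Unset Strict Implicit.
Unset Printing Implicit Defensive.

Import Order.TTheory GRing.Theory Num.Theory.
Import numFieldNormedType.Exports.
Import Normc.

Local Open Scope classical_set_scope.
Local Open Scope ring_scope.

(* The usual topology and norm on the complex numbers. *)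
HB.instance Definition _ (R : realType) := NormedModule.copy R[i] R[i]^o.

Section EsumScale.
Local Open Scope ereal_scope.
Context {R : realType} {T : choiceType}.
Implicit Types a : T -> \bar R.

Lemma esumZ_le (c : R) a : (0 <= c)%R -> (forall x, 0 <= a x) ->
  \esum_(x in [set: T]) (c%:E * a x) <= c%:E * \esum_(x in [set: T]) a x.
Proof.
move=> c0 a0; apply: ge_ereal_sup => _ [A [fA _] <-].
rewrite -ge0_mule_fsumr//; apply: lee_wpmul2l; first by rewrite lee_fin.
by apply: ereal_sup_ubound; exists A.
Qed.

End EsumScale.

Section L2.
Variables (R : realType) (G : choiceType).
Local Notation C := R[i].
Implicit Types f g : G -> C.

Definition sqnorm f : \bar R := \esum_(x in [set: G]) (normc (f x) ^+ 2)%:E.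

Definition square_summable f : Prop := (sqnorm f < +oo)%E.

Lemma sqnorm_ge0 f : (0 <= sqnorm f)%E.
Proof. by apply: esum_ge0 => x _; rewrite lee_fin sqr_ge0. Qed.

Lemma sqnorm_fin f : square_summable f -> sqnorm f \is a fin_num.
Proof. by move=> ?; rewrite ge0_fin_numE// sqnorm_ge0. Qed.

Lemma normc_ge0 (z : C) : 0 <= normc z.
Proof. by case: z => x y; exact: sqrtr_ge0. Qed.

Lemma sqnormZ_le (l : C) f :
  (sqnorm (l *: f) <= ((normc l) ^+ 2)%:E * sqnorm f)%E.
Proof.
apply: le_trans (esumZ_le _ _); last 2 first.
  exact: sqr_ge0.
  by move=> x; rewrite lee_fin sqr_ge0.
by apply: le_esum => x _; rewrite -EFinM lee_fin normcM exprMn.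
Qed.

Lemma sqnormD_le (t : R) f g : 0 < t ->
  (sqnorm (f + g)%R <= (1 + t)%:E * sqnorm f + (1 + t^-1)%:E * sqnorm g)%E.
Proof.
move=> t0; have [a0 b0] : 0 <= 1 + t /\ 0 <= 1 + t^-1.
  by split; rewrite addr_ge0// ?invr_ge0 ltW.
apply: le_trans; last first.
  by apply: leeD; apply: esumZ_le => // x; rewrite lee_fin sqr_ge0.
rewrite -esumD; last 2 first.
  by move=> x _; rewrite -EFinM lee_fin mulr_ge0// sqr_ge0.
  by move=> x _; rewrite -EFinM lee_fin mulr_ge0// sqr_ge0.
apply: le_esum => x _; rewrite -!EFinM -EFinD lee_fin.
set u := normc (f x); set v := normc (g x).
have uv : normc ((f + g) x) <= u + v by exact: le_normcD.
apply: (@le_trans _ _ ((u + v) ^+ 2)).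
  by rewrite ler_pXn2r// nnegrE ?addr_ge0 ?normc_ge0.
rewrite -subr_ge0; have -> : (1 + t) * u ^+ 2 + (1 + t^-1) * v ^+ 2 - (u + v) ^+ 2
   = t^-1 * (t * u - v) ^+ 2.
  by field; rewrite gt_eqF.
by apply: mulr_ge0; [rewrite invr_ge0 ltW | exact: sqr_ge0].
Qed.

Definition l2norm f : R := Num.sqrt (fine (sqnorm f)).

Lemma sqr_l2norm f : square_summable f -> sqnorm f = (l2norm f ^+ 2)%:E.
Proof.
move=> sf; rewrite sqr_sqrtr ?fineK ?sqnorm_fin//.
exact/fine_ge0/sqnorm_ge0.
Qed.

Lemma square_summable0 : square_summable (0 : G -> C).
Proof.
by rewrite /square_summable /sqnorm esum1// => x _; rewrite normc0 expr0n.
Qed.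

Lemma square_summableD f g :
  square_summable f -> square_summable g -> square_summable (f + g).
Proof.
move=> sf sg; apply: (le_lt_trans (@sqnormD_le 1 f g ltr01)).
by rewrite (sqr_l2norm sf) (sqr_l2norm sg) -!EFinM -EFinD ltry.
Qed.

Lemma square_summableZ (l : C) f : square_summable f -> square_summable (l *: f).
Proof.
move=> sf; apply: (le_lt_trans (sqnormZ_le l f)).
by rewrite (sqr_l2norm sf) -EFinM ltry.
Qed.

Lemma l2norm_ge0 f : 0 <= l2norm f. Proof. exact: sqrtr_ge0. Qed.

Lemma l2norm_eq0 f : square_summable f -> l2norm f = 0 -> f = 0.
Proof.
move=> sf f0; apply/funext => x; apply: eq0_normc.
have : sqnorm f = 0%E by rewrite sqr_l2norm// f0 expr0n.
move=> s0; have : ((normc (f x) ^+ 2)%:E <= sqnorm f)%E.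
  apply: esum_ge; exists [set x]; last by rewrite fsbig_set1.
  by split.
rewrite s0 lee_fin => h; apply/eqP; rewrite -sqrf_eq0 eq_le h/=.
exact: sqr_ge0.
Qed.

Lemma l2normZ_le (l : C) f : square_summable f ->
  l2norm (l *: f) <= normc l * l2norm f.
Proof.
move=> sf; rewrite -(@ler_pXn2r _ 2)// ?nnegrE ?mulr_ge0 ?normc_ge0 ?l2norm_ge0//.
rewrite -lee_fin -sqr_l2norm; last exact: square_summableZ.
by rewrite exprMn EFinM -sqr_l2norm//; exact: sqnormZ_le.
Qed.

Lemma l2normZ (l : C) f : square_summable f ->
  l2norm (l *: f) = normc l * l2norm f.
Proof.
move=> sf; apply/eqP; rewrite eq_le l2normZ_le//=.
have [->|l0] := eqVneq l 0; first by rewrite normc0 mul0r l2norm_ge0.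
have nl0 : 0 < normc l.
  rewrite lt_neqAle normc_ge0 andbT eq_sym.
  by apply: contra_neq l0; exact: eq0_normc.
have := l2normZ_le l^-1 (square_summableZ l sf).
by rewrite scalerA mulVf// scale1r normcV ler_pdivlMl.
Qed.

Lemma l2normD_le f g : square_summable f -> square_summable g ->
  l2norm (f + g) <= l2norm f + l2norm g.
Proof.
move=> sf sg.
have [f0|f0] := eqVneq (l2norm f) 0.
  by rewrite f0 (l2norm_eq0 sf f0) !add0r.
have [g0|g0] := eqVneq (l2norm g) 0.
  by rewrite g0 (l2norm_eq0 sg g0) !addr0.
have {}f0 : 0 < l2norm f by rewrite lt_neqAle l2norm_ge0 eq_sym f0.
have {}g0 : 0 < l2norm g by rewrite lt_neqAle l2norm_ge0 eq_sym g0.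
rewrite -(@ler_pXn2r _ 2)// ?nnegrE ?addr_ge0 ?l2norm_ge0//.
rewrite -lee_fin -sqr_l2norm; last exact: square_summableD.
apply: (le_trans (@sqnormD_le (l2norm g / l2norm f) f g _)).
  exact: divr_gt0.
rewrite !sqr_l2norm// -!EFinM -EFinD lee_fin le_eqVlt; apply/orP; left.
by apply/eqP; field; rewrite !gt_eqF.
Qed.

Definition l2_pred : {pred G -> C} := fun f => `[< square_summable f >].

Record l2 := L2 { l2fun :> G -> C ; l2P : l2fun \in l2_pred }.

HB.instance Definition _ := [isSub for l2fun].
HB.instance Definition _ := [Choice of l2 by <:].

Lemma l2_square_summable (f : l2) : square_summable f.
Proof. by have /asboolP := l2P f. Qed.

Lemma l2_submod_closed : submod_closed l2_pred.
Proof.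
split=> [|l f g]; first exact/asboolP/square_summable0.
move=> /asboolP sf /asboolP sg; apply/asboolP.
exact/square_summableD/sg/square_summableZ.
Qed.

HB.instance Definition _ :=
  GRing.isSubmodClosed.Build C (G -> C) l2_pred l2_submod_closed.

HB.instance Definition _ := [SubChoice_isSubLmodule of l2 by <:].

Lemma l2normD (f g : l2) :
  (l2norm (f + g : l2))%:C%C <= (l2norm f)%:C%C + (l2norm g)%:C%C :> C.
Proof. by rewrite -rmorphD lecR; apply: l2normD_le; exact: l2_square_summable. Qed.

Lemma l2normcZ (l : C) (f : l2) :
  (l2norm (l *: f : l2))%:C%C = `|l| * (l2norm f)%:C%C.
Proof.
rewrite [l2norm _]l2normZ; last exact: l2_square_summable.
by rewrite rmorphM.
Qed.

Lemma l2normc_eq0 (f : l2) : (l2norm f)%:C%C = 0 :> C -> f = 0.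
Proof.
move=> /complexI f0; apply: val_inj.
exact/l2norm_eq0/f0/l2_square_summable.
Qed.

(* Norms of normed spaces over R[i] are R[i]-valued. *)
HB.instance Definition _ :=
  Lmodule_isNormed.Build C l2 l2normD l2normcZ l2normc_eq0.

(* Limit of the finite partial sums along the directed set of finite subsets of
   G; linear in the first argument. *)
Definition l2dot (f g : l2) : C := summability.sum (fun x => f x * (g x)^*%C).

End L2.
Arguments l2 : clear implicits.

(* Borel measurability: the target carries the sigma-algebra generated by its
   open sets. *)
Definition borel_measurable {d} {Omega : measurableType d}
    {T : ptopologicalType} (X : Omega -> T) : Prop :=
  measurable_fun [set: Omega] (X : Omega -> g_sigma_algebraType (@open T)).

(* Possibly unbounded operators in l2(G), given by their graphs in
   l2(G) x l2(G). *)
Section Operators.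
Variables (R : realType) (G : choiceType).
Local Notation C := R[i].
Local Notation H := (l2 R G).
Implicit Types T : set (H * H).

Definition is_operator T : Prop :=
  [/\ T (0, 0),
      forall (c : C) p q, T p -> T q -> T (c *: p + q) &
      forall f g g', T (f, g) -> T (f, g') -> g = g'].

Definition dom T : set H := [set f | exists g, T (f, g)].

Definition adjoint T : set (H * H) :=
  [set p | forall f g, T (f, g) -> l2dot g p.1 = l2dot f p.2].

Definition self_adjoint T : Prop :=
  [/\ is_operator T, dense (dom T) & adjoint T = T].

(* [closure T] is the closure of the graph in the product topology, so the last
   clause says that T is closable and that its closure is self-adjoint. *)
Definition essentially_self_adjoint T : Prop :=
  [/\ is_operator T, dense (dom T) & self_adjoint (closure T)].

Definition id_operator : set (H * H) := [set p | p.2 = p.1].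

Definition bounded_operator (S : H -> H) : Prop :=
  linear S /\ exists M : R, forall f, `|S f| <= M%:C%C * `|f|.

(* (z - T)^-1, to be used only for z in [resolvent_set T]; elsewhere [get]
   returns arbitrary values. *)
Definition resolvent T (z : C) : H -> H :=
  fun xi => get [set f | exists2 g, T (f, g) & z *: f - g = xi].

Definition resolvent_set T : set C :=
  [set z | (forall xi, exists! f, exists2 g, T (f, g) & z *: f - g = xi) /\
           bounded_operator (resolvent T z)].

Definition strongly_measurable {d} {Omega : measurableType d}
    (S : Omega -> H -> H) : Prop :=
  (forall w, bounded_operator (S w)) /\
  forall xi : H, borel_measurable (fun w => S w xi).

Definition D0 : set H := [set f | finite_set [set x | f x != 0]].

(* The sum over G is the library's finite-support sum: its value is meaningful
   when f has finite support. *)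
Definition kernel_action (k : G -> G -> C) (f : G -> C) : G -> C :=
  fun x => \sum_(y \in [set: G]) k x y * f y.

Definition kernel_operator (k : G -> G -> C) : set (H * H) :=
  [set p | D0 p.1 /\ l2fun p.2 = kernel_action k p.1].

End Operators.

(* Main.v *)
From HB Require Import structures.
Require Import Defs.
From mathcomp Require Import all_boot all_order all_algebra.
From mathcomp Require Import finmap complex ring lra.
From mathcomp Require Import all_classical all_reals all_analysis.
From mathcomp Require Import measurable_realfun measurable_fun_approximation.
From mathcomp.analysis.showcase Require summability.

(** Write A for the operator with kernel a on finitely supported vectors. By the
    basic criterion, a symmetric operator is essentially self-adjoint as soon as
    z - A has dense range for z in both half planes. Approximate solutions of
    (z - A) v = delta_x are produced from bounded truncations of A, and the
    error is controlled in mean square by stationarity.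

    Fix z = s + i t with t <> 0. Keep the entries a(x, y) with y x^-1 in a
    finite symmetric set K and modulus at most m: this gives a bounded hermitian
    operator T of finite range. A polynomial Q in T satisfies
    (z - T) Q = 1 - B ^ n with |B| < 1 and |Q| <= 2 / |t|, a bound in which K, m
    and n do not occur ([poly_resolvent_le], [residual_le]). As Q is a polynomial
    in a finite range operator, v = Q delta_x has a support that does not depend
    on the randomness, so that v lies in the domain of A, and
    (z - A) v - delta_x = - B ^ n delta_x - (A - T) Q delta_x.

    The operator A - T may be unbounded, but the mean square of its contribution
    is controlled: moving every entry (y, x) to (1, x y^-1) by stationarity, [mass_transport]
    turns E sum_y |((A - T) Q)(y, x)|^2 into E sum_u |((A - T) Q)(1, u)|^2. The
    latter is the squared norm of the transpose of Q applied to the row of A - T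
    at the identity, hence at most (2 / |t|)^2 times the mean squared norm of
    that row ([transpose_bound]). The moment hypothesis makes the rows of A
    square integrable, so this tends to 0 as K grows to G and m to infinity
    ([remainder_small]). The outcome is [approximate_resolvent].

    Choosing summable mean square errors, almost surely (z - A) v_n tends to
    delta_x for all x in G and all non-real Gaussian rationals z, countably many
    conditions. On that event the range of z - A is dense for these z, hence for all non-real z
    ([approx_range_near]); completeness of l2(G) and the lower bound
    |Im z| |f| <= |(z - A) f| make z minus the closure of A bijective
    ([closure_surj]), and self-adjointness follows
    ([full_symmetric_self_adjoint]).

    As G is countable, l2(G) is separable and a map into it is Borel as soon as
    its coordinates are ([l2_borel_measurable]). The coordinates of the
    resolvent at delta_x are limits of those of v_n; linearity and continuity in
    the vector and in z give the remaining resolvents ([resolvent_measurable]). *)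

Set Implicit Arguments.
Unset Strict Implicit.
Unset Printing Implicit Defensive.

Import Order.TTheory GRing.Theory Num.Theory.
Import numFieldNormedType.Exports.
Import Normc.

Local Open Scope classical_set_scope.
Local Open Scope ring_scope.

(** * Complex numbers *)

Section ComplexFacts.
Variable R : realType.
Implicit Types z w : R[i].
Local Notation Re := (@complex.Re R).
Local Notation Im := (@complex.Im R).

Lemma normc_sq z : normc z ^+ 2 = Re z ^+ 2 + Im z ^+ 2.
Proof. by case: z => x y; rewrite sqr_sqrtr//= addr_ge0// sqr_ge0. Qed.

Lemma normcD z w : normc (z + w) <= normc z + normc w.
Proof. exact: le_normcD. Qed.

Lemma normc_opp z : normc (- z) = normc z.
Proof. exact: normcN. Qed.

Lemma normc_conj z : normc z^*%C = normc z.
Proof. by case: z => x y; rewrite /= sqrrN. Qed.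

Lemma normc_real (x : R) : normc x%:C%C = `|x|.
Proof. by rewrite /= expr0n addr0 sqrtr_sqr. Qed.

Lemma Re_add z w : Re (z + w) = Re z + Re w. Proof. by case: z; case: w. Qed.
Lemma Im_add z w : Im (z + w) = Im z + Im w. Proof. by case: z; case: w. Qed.
Lemma Re_opp z : Re (- z) = - Re z. Proof. by case: z. Qed.
Lemma Im_opp z : Im (- z) = - Im z. Proof. by case: z. Qed.
Lemma Re_mul z w : Re (z * w) = Re z * Re w - Im z * Im w.
Proof. by case: z; case: w. Qed.
Lemma Im_mul z w : Im (z * w) = Re z * Im w + Im z * Re w.
Proof. by case: z; case: w. Qed.

Lemma normc_Re z : `|Re z| <= normc z.
Proof.
rewrite -(@ler_pXn2r _ 2)// ?nnegrE ?normr_ge0 ?normc_ge0//.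
by rewrite normc_sq real_normK ?num_real// lerDl sqr_ge0.
Qed.

Lemma normc_Im z : `|Im z| <= normc z.
Proof.
rewrite -(@ler_pXn2r _ 2)// ?nnegrE ?normr_ge0 ?normc_ge0//.
by rewrite normc_sq real_normK ?num_real// lerDr sqr_ge0.
Qed.

Lemma normc_le_ReIm z : normc z <= `|Re z| + `|Im z|.
Proof.
rewrite -(@ler_pXn2r _ 2)// ?nnegrE ?addr_ge0 ?normc_ge0//.
rewrite normc_sq sqrrD !real_normK ?num_real//.
by rewrite -addrA [_ *+ 2 + _]addrC addrA lerDl mulrn_wge0// mulr_ge0.
Qed.

Lemma mulc_conj z : z * z^*%C = (normc z ^+ 2)%:C%C.
Proof.
by rewrite normc_sq; case: z => x y; apply/eqP; rewrite eq_complex/=; apply/andP; split; apply/eqP; ring.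
Qed.

Lemma normc_small z : (forall e : R, 0 < e -> normc z <= e) -> z = 0.
Proof.
move=> h; apply: eq0_normc; apply/eqP; rewrite eq_le normc_ge0 andbT.
by apply/ler_addgt0Pl => e e0; rewrite addr0 h.
Qed.

(** The norm of R[i] takes its values in R[i]; all estimates below are made with
    the real modulus instead. *)
Lemma cvgcP {T : Type} (F : set_system T) {FF : Filter F} (f : T -> R[i]) z :
  f @ F --> z <-> forall e : R, 0 < e -> \forall t \near F, normc (z - f t) < e.
Proof.
split=> [/cvgrPdist_lt h e e0|h].
  have e0' : 0 < e%:C%C :> R[i] by rewrite ltcR.
  by have := h _ e0'; apply: filterS => t; rewrite [ `|_| ]/(normc _)%:C%C ltcR.
apply/cvgrPdist_lt => e e0.
have [ie re] : Im e = 0 /\ 0 < Re e by move: e0; rewrite ltcE => /andP[/eqP/= -> ->].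
have -> : e = (Re e)%:C%C by case: e ie {re e0} => a b /= ->.
by have := h _ re; apply: filterS => t; rewrite [ `|_| ]/(normc _)%:C%C ltcR.
Qed.

End ComplexFacts.

(** * Unordered sums of complex families *)

Section HasSum.
Variables (R : realType) (I : choiceType).
Implicit Types (f g : I -> R[i]) (l : R[i]) (A B : {fset I}).
#[local] Existing Instance summability.totally_filter.

(** The convergence behind [summability.sum], as a relation: it keeps existence
    and value together and is visibly stable under linear operations. *)
Definition has_sum f l : Prop := forall e : R, 0 < e ->
  exists A, forall B, (A `<=` B)%fset -> normc (l - \sum_(x <- B) f x) < e.

Lemma has_sum_cvg f l : has_sum f l <->
  summability.partial_sum f @ summability.totally --> l.
Proof.
have E A : summability.partial_sum f A = \sum_(x <- A) f x.
  by rewrite /summability.partial_sum big_seq_fsetE.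
split.
  move=> h; apply/cvgcP => e /h[A hA]; exists A => // B /= AB.
  by rewrite E; exact: hA.
move=> /cvgcP h e /h[A _ hA]; exists A => B AB.
by rewrite -E; exact: hA.
Qed.

Lemma has_sumE f l : has_sum f l -> summability.sum f = l.
Proof. by move=> /has_sum_cvg h; apply: cvg_lim. Qed.

Lemma has_sumD f g l m :
  has_sum f l -> has_sum g m -> has_sum (fun x => f x + g x) (l + m).
Proof.
move=> hf hg e e0; have e2 : 0 < e / 2 by lra.
have [A hA] := hf _ e2; have [B hB] := hg _ e2.
exists (A `|` B)%fset => D; rewrite fsubUset => /andP[/hA h1 /hB h2].
rewrite big_split/= opprD addrACA (le_lt_trans (normcD _ _))//; lra.
Qed.

Lemma has_sumZ c f l : has_sum f l -> has_sum (fun x => c * f x) (c * l).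
Proof.
move=> hf e e0; have k0 : 0 < 1 + normc c by rewrite ltr_pwDl// normc_ge0.
have [A hA] := hf _ (divr_gt0 e0 k0); exists A => B /hA.
rewrite -mulr_sumr -mulrBr normcM ltr_pdivlMr// => h.
rewrite (le_lt_trans _ h)// mulrC; have := normc_ge0 (l - \sum_(x <- B) f x); nra.
Qed.

Lemma has_sum_conj f l : has_sum f l -> has_sum (fun x => (f x)^*%C) l^*%C.
Proof.
move=> hf e e0; have [A hA] := hf _ e0; exists A => B /hA.
by rewrite -rmorph_sum -rmorphB normc_conj.
Qed.

Lemma eq_has_sum f g l : f =1 g -> has_sum f l -> has_sum g l.
Proof. by move=> /funext ->. Qed.

Lemma fsets_fset (S : set I) X : fsets S X ->
  exists A : {fset I}, X = [set` A].
Proof. by move=> [/finite_fsetP[A ->] _]; exists A. Qed.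

Lemma has_sum_nonneg (r : I -> R) (s : R) : (forall x, 0 <= r x) ->
  (\esum_(x in [set: I]) (r x)%:E = s%:E)%E ->
  has_sum (fun x => (r x)%:C%C) s%:C%C.
Proof.
move=> r0 rs e e0.
have E B : \sum_(x <- B) (r x)%:C%C = (\sum_(x <- B) r x)%:C%C :> R[i].
  by rewrite rmorph_sum.
have ub B : \sum_(x <- B) r x <= s.
  rewrite -lee_fin -rs; apply: esum_ge; exists [set` B]; last first.
    rewrite fsbig_finite//= set_fsetK sumEFin//.
  by split.
have : (s%:E - e%:E < \esum_(x in [set: I]) (r x)%:E)%E.
  by rewrite rs -EFinB lte_fin ltrBlDr ltrDl.
move=> /ereal_sup_gt[_ [X /fsets_fset[A ->] <-]].
rewrite fsbig_finite//= set_fsetK sumEFin -EFinB lte_fin => hA.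
exists A => B AB; rewrite E -rmorphB normc_real ger0_norm ?subr_ge0//.
suff : \sum_(x <- A) r x <= \sum_(x <- B) r x by lra.
rewrite [leRHS](big_fsetIDcond _ (mem A))/=.
have -> : [fset x in B | x \in A]%fset = A.
  apply/fsetP => x; rewrite !inE/=; case: (boolP (x \in A)) => xA; rewrite ?andbF// andbT.
  exact: (fsubsetP AB).
by rewrite lerDl sumr_ge0.
Qed.

(** The positive and negative parts are summed separately, since increasing nets
    of partial sums converge to their supremum. *)
Lemma has_sum_real (r : I -> R) :
  (\esum_(x in [set: I]) `|r x|%:E < +oo)%E -> exists l, has_sum (fun x => (r x)%:C%C) l.
Proof.
move=> h.
have P (s : I -> R) : (forall x, 0 <= s x <= `|r x|) -> exists l, has_sum (fun x => (s x)%:C%C) l.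
  move=> sr.
  have s0 : (0 <= \esum_(x in [set: I]) (s x)%:E)%E.
    by apply: esum_ge0 => x _; rewrite lee_fin; case/andP: (sr x).
  have sfin : \esum_(x in [set: I]) (s x)%:E \is a fin_num.
    rewrite ge0_fin_numE//; apply: le_lt_trans h; apply: le_esum => x _.
    by rewrite lee_fin; case/andP: (sr x).
  exists (fine (\esum_(x in [set: I]) (s x)%:E))%:C%C.
  by apply: has_sum_nonneg; [move=> x; case/andP: (sr x) | rewrite fineK].
have [|l1 h1] := P (fun x => (`|r x| + r x) / 2).
  by move=> x; have := ler_norm (r x); have := ler_norm (- r x); rewrite normrN; lra.
have [|l2 h2] := P (fun x => (`|r x| - r x) / 2).
  by move=> x; have := ler_norm (r x); have := ler_norm (- r x); rewrite normrN; lra.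
exists (l1 + (-1) * l2); apply: eq_has_sum (has_sumD h1 (has_sumZ (-1) h2)) => x.
rewrite mulN1r -rmorphB/=; congr (_%:C)%C; lra.
Qed.

Lemma has_sum_abs f :
  (\esum_(x in [set: I]) (normc (f x))%:E < +oo)%E -> exists l, has_sum f l.
Proof.
move=> h.
have [|l1 h1] := @has_sum_real (fun x => complex.Re (f x)).
  apply: le_lt_trans h; apply: le_esum => x _; rewrite lee_fin; exact: normc_Re.
have [|l2 h2] := @has_sum_real (fun x => complex.Im (f x)).
  apply: le_lt_trans h; apply: le_esum => x _; rewrite lee_fin; exact: normc_Im.
exists (l1 + 'i%C * l2); apply: eq_has_sum (has_sumD h1 (has_sumZ _ h2)) => x.
by rewrite -complexE.
Qed.

Lemma has_sum_fin f (A : {fset I}) : (forall x, x \notin A -> f x = 0) ->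
  has_sum f (\sum_(x <- A) f x).
Proof.
move=> fA e e0; exists A => B AB.
rewrite [X in _ - X](big_fsetIDcond _ (mem A))/=.
have -> : [fset x in B | x \in A]%fset = A.
  apply/fsetP => x; rewrite !inE/=; case: (boolP (x \in A)) => xA; rewrite ?andbF// andbT.
  exact: (fsubsetP AB).
rewrite [X in _ - (_ + X)]big1_seq ?addr0 ?subrr ?normc0// => x.
by rewrite !inE/= => /andP[_ /fA].
Qed.

End HasSum.

(** * The Hilbert space of square summable families *)

Lemma real_cauchy_cvg (R : realType) (u : nat -> R) :
  (forall e : R, 0 < e -> exists N, forall m n, (N <= m)%N -> (N <= n)%N ->
     `|u m - u n| <= e) -> cvgn u.
Proof.
move=> cu; apply/cauchy_cvgP/cauchy_exP => e e0.
have [|N hN] := cu (e / 2); first by rewrite divr_gt0.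
exists (u N); exists N => // n /= Nn; rewrite /ball/= (le_lt_trans (hN _ _ _ Nn))//.
by rewrite ltr_pdivrMr// ltr_pMr// ltr1n.
Qed.

Section HilbertSpace.
Variables (R : realType) (G : choiceType).
Local Notation H := (l2 R G).
Local Notation Re := (@complex.Re R).
Local Notation Im := (@complex.Im R).
Local Notation "''|' f |" := (l2norm (l2fun f)) (at level 0, f at level 99, format "''|' f |").
Implicit Types (f g h : H) (c : R[i]).

Lemma l2E f g : l2fun f = l2fun g -> f = g.
Proof. exact: val_inj. Qed.

Lemma l2DE f g x : (f + g) x = f x + g x. Proof. by []. Qed.
Lemma l2ZE c f x : (c *: f) x = c * f x. Proof. by []. Qed.
Lemma l2NE f x : (- f) x = - f x. Proof. by []. Qed.
Lemma l20E x : (0 : H) x = 0. Proof. by []. Qed.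
Lemma l2BE f g x : (f - g) x = f x - g x. Proof. by []. Qed.
Definition l2_coordE := (l2DE, l2ZE, l2NE, l20E).

#[local] Hint Resolve l2_square_summable : core.

Lemma esum_fin_support (r : G -> \bar R) (A : {fset G}) : (forall x, 0 <= r x)%E ->
  (forall x, x \notin A -> r x = 0%E) ->
  (\esum_(x in [set: G]) r x = \sum_(x <- A) r x)%E.
Proof.
move=> r0 rA; transitivity (\sum_(x \in [set` A]) r x)%E; last by rewrite fsbig_finite//= set_fsetK.
rewrite -esum_fset//.
rewrite [RHS]esum_mkcond; apply: eq_esum => x _.
by case: ifPn => //; rewrite notin_setE/= => /negP /rA.
Qed.

Lemma esum_ge_fset (r : G -> \bar R) (A : {fset G}) : (forall x, 0 <= r x)%E ->
  (\sum_(x <- A) r x <= \esum_(x in [set: G]) r x)%E.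
Proof.
move=> r0; apply: esum_ge; exists [set` A]; first by split.
by rewrite fsbig_finite//= set_fsetK.
Qed.

Lemma esum_le_ub (r : G -> \bar R) (s : \bar R) :
  (forall A : {fset G}, \sum_(x <- A) r x <= s)%E -> (\esum_(x in [set: G]) r x <= s)%E.
Proof.
move=> h; apply: ge_ereal_sup => _ [X /fsets_fset[A ->] <-].
by rewrite fsbig_finite//= set_fsetK.
Qed.

Lemma sqnorm_ge_fset (f : G -> R[i]) (A : {fset G}) :
  ((\sum_(x <- A) normc (f x) ^+ 2)%:E <= sqnorm f)%E.
Proof.
by rewrite -sumEFin; apply: esum_ge_fset => x; rewrite lee_fin sqr_ge0.
Qed.

Lemma sqnorm_le_ub (f : G -> R[i]) (s : R) :
  (forall A : {fset G}, \sum_(x <- A) normc (f x) ^+ 2 <= s) -> (sqnorm f <= s%:E)%E.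
Proof. by move=> h; apply: esum_le_ub => A; rewrite sumEFin lee_fin. Qed.

Lemma sqnorm_fset (f : G -> R[i]) (A : {fset G}) :
  (forall x, x \notin A -> f x = 0) ->
  sqnorm f = (\sum_(x <- A) normc (f x) ^+ 2)%:E.
Proof.
move=> fA; rewrite -sumEFin; apply: esum_fin_support => x.
  by rewrite lee_fin sqr_ge0.
by move=> /fA ->; rewrite normc0 expr0n.
Qed.

(** Absolute convergence comes from |f x| |g x| <= |f x|^2 + |g x|^2; it is what
    makes the limit defining [l2dot] exist. *)
Lemma has_sum_dot f g : has_sum (fun x => f x * (g x)^*%C) (l2dot f g).
Proof.
have [l hl] : exists l, has_sum (fun x => f x * (g x)^*%C) l.
  apply: has_sum_abs; apply: (@le_lt_trans _ _ (sqnorm f + sqnorm g)%E); last first.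
    by rewrite lte_add_pinfty// l2_square_summable.
  rewrite -esumD; last 2 first.
  - by move=> x _; rewrite lee_fin sqr_ge0.
  - by move=> x _; rewrite lee_fin sqr_ge0.
  apply: le_esum => x _; rewrite -EFinD lee_fin normcM normc_conj.
  have := normc_ge0 (f x); have := normc_ge0 (g x); nra.
by rewrite /l2dot (has_sumE hl).
Qed.

Lemma l2dot_eq f g l : has_sum (fun x => f x * (g x)^*%C) l -> l2dot f g = l.
Proof. exact: has_sumE. Qed.

Lemma dotDl f g h : l2dot (f + g) h = l2dot f h + l2dot g h.
Proof.
apply: l2dot_eq; apply: eq_has_sum (has_sumD (has_sum_dot f h) (has_sum_dot g h)) => x.
by rewrite l2DE mulrDl.
Qed.

Lemma dotZl c f h : l2dot (c *: f) h = c * l2dot f h.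
Proof.
apply: l2dot_eq; apply: eq_has_sum (has_sumZ c (has_sum_dot f h)) => x.
by rewrite l2ZE mulrA.
Qed.

Lemma dotC f g : l2dot f g = (l2dot g f)^*%C.
Proof.
apply: l2dot_eq; apply: eq_has_sum (has_sum_conj (has_sum_dot g f)) => x.
by rewrite rmorphM /= conjcK mulrC.
Qed.

Lemma dotDr f g h : l2dot h (f + g) = l2dot h f + l2dot h g.
Proof. by rewrite dotC dotDl rmorphD/= -!dotC. Qed.

Lemma dotZr c f h : l2dot h (c *: f) = c^*%C * l2dot h f.
Proof. by rewrite dotC dotZl rmorphM/= -!dotC. Qed.

Lemma dotNl f h : l2dot (- f) h = - l2dot f h.
Proof. by rewrite -scaleN1r dotZl mulN1r. Qed.

Lemma dotNr f h : l2dot h (- f) = - l2dot h f.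
Proof. by rewrite dotC dotNl rmorphN/= -dotC. Qed.

Lemma dotff f : l2dot f f = ('|f| ^+ 2)%:C%C.
Proof.
apply: l2dot_eq.
apply: (@eq_has_sum _ _ (fun x => (normc (f x) ^+ 2)%:C%C)).
  by move=> x; rewrite mulc_conj.
apply: has_sum_nonneg => [x|]; first exact: sqr_ge0.
exact: sqr_l2norm.
Qed.

Lemma sqr_norml2D f g : '|f + g| ^+ 2 = '|f| ^+ 2 + 2 * Re (l2dot f g) + '|g| ^+ 2.
Proof.
apply: complexI; rewrite -dotff dotDl !dotDr !dotff (dotC g f).
rewrite -!addrA rmorphD/= rmorphD/=; congr (_ + _); rewrite addrA; congr (_ + _).
by rewrite addcJ rmorphM/= rmorph_nat.
Qed.

Lemma norml2Z c f : '|c *: f| = normc c * '|f|.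
Proof. exact: (l2normZ c (l2_square_summable f)). Qed.

Lemma norml2N f : '|- f| = '|f|.
Proof. by rewrite -scaleN1r norml2Z normc_opp normc1 mul1r. Qed.

Lemma sqr_norml2B f g : '|f - g| ^+ 2 = '|f| ^+ 2 - 2 * Re (l2dot f g) + '|g| ^+ 2.
Proof. by rewrite sqr_norml2D dotNr Re_opp norml2N mulrN. Qed.

Lemma norml2D f g : '|f + g| <= '|f| + '|g|. Proof. exact: (l2normD_le (l2_square_summable f) (l2_square_summable g)). Qed.
Lemma norml2B f g : '|f - g| <= '|f| + '|g|.
Proof. by rewrite -(norml2N g) norml2D. Qed.
Lemma norml2_eq0 f : '|f| = 0 -> f = 0.
Proof. by move=> h; apply: l2E; exact: l2norm_eq0. Qed.
Lemma norml20 : '|0 : H| = 0.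
Proof. by rewrite -(scale0r (0 : H)) norml2Z normc0 mul0r. Qed.
Lemma norml2_distC f g : '|f - g| = '|g - f|.
Proof. by rewrite -opprB norml2N. Qed.

Lemma Re_realM (x : R) c : Re (x%:C%C * c) = x * Re c.
Proof. by rewrite Re_mul/= mul0r subr0. Qed.

(** Cauchy-Schwarz, by expanding the squared norm of |g| f - |f| g. *)
Lemma Re_dot_le f g : Re (l2dot f g) <= '|f| * '|g|.
Proof.
have [g0|g0] := eqVneq '|g| 0.
  by rewrite g0 mulr0 (norml2_eq0 g0) -(scale0r (0 : H)) dotZr rmorph0 mul0r.
have gp : 0 < '|g| by rewrite lt_neqAle eq_sym g0 l2norm_ge0.
have := sqr_ge0 '|'|g|%:C%C *: f - '|f|%:C%C *: g|.
rewrite sqr_norml2B !norml2Z dotZl dotZr conjc_real !normc_real !ger0_norm ?l2norm_ge0//.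
rewrite !Re_realM.
have [f0 _|f0] := eqVneq '|f| 0.
  rewrite f0 mul0r (norml2_eq0 f0) -(scale0r (0 : H)) dotZl mul0r//.
have fp : 0 < '|f| by rewrite lt_neqAle eq_sym f0 l2norm_ge0.
move: (Re _) => d.
have -> : ('|g| * '|f|) ^+ 2 - 2 * ('|g| * ('|f| * d)) + ('|f| * '|g|) ^+ 2 =
  2 * ('|f| * '|g|) * ('|f| * '|g| - d) by ring.
by rewrite pmulr_rge0 ?subr_ge0// !mulr_gt0.
Qed.

Lemma normc_dot_le f g : normc (l2dot f g) <= '|f| * '|g|.
Proof.
set d := l2dot f g; have [->|d0] := eqVneq d 0.
  by rewrite normc0 mulr_ge0// l2norm_ge0.
have nd : 0 < normc d.
  by rewrite lt_neqAle normc_ge0 andbT eq_sym; apply: contra_neq d0; exact: eq0_normc.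
have := Re_dot_le (d^*%C *: f) g.
rewrite dotZl norml2Z normc_conj mulrC -/d mulc_conj/= expr2 -mulrA.
by rewrite ler_pM2l.
Qed.

(** * Point masses and finite truncations *)

Definition restrict (A : {fset G}) (f : G -> R[i]) : G -> R[i] :=
  fun x => if x \in A then f x else 0.

Lemma square_summable_fin (f : G -> R[i]) (A : {fset G}) :
  (forall x, x \notin A -> f x = 0) -> square_summable f.
Proof. by move=> fA; rewrite /square_summable (sqnorm_fset fA) ltry. Qed.

Lemma restrict_l2P A (f : G -> R[i]) : restrict A f \in l2_pred (G := G).
Proof.
by apply/asboolP; apply: (@square_summable_fin _ A) => x; rewrite /restrict => /negbTE ->.
Qed.

Definition l2restrict A (f : G -> R[i]) : H := L2 (restrict_l2P A f).

Definition delta (x : G) : H := l2restrict [fset x]%fset (fun=> 1).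

Lemma deltaE x y : delta x y = (y == x)%:R.
Proof. by rewrite /= /restrict inE; case: (y == x). Qed.

Lemma dot_delta f x : l2dot f (delta x) = f x.
Proof.
apply: l2dot_eq; have := @has_sum_fin _ _ (fun y => f y * (delta x y)^*%C) [fset x]%fset.
rewrite big_seq_fset1 deltaE eqxx conjc1 mulr1; apply => y.
by rewrite inE deltaE => /negbTE ->; rewrite conjc0 mulr0.
Qed.

Lemma l2norm_delta x : '|delta x| = 1.
Proof.
apply/eqP; rewrite -(@eqrXn2 _ 2)// ?l2norm_ge0// expr1n.
by apply/eqP; apply: complexI; rewrite -dotff dot_delta deltaE eqxx.
Qed.

Lemma normc_coord_le f x : normc (f x) <= '|f|.
Proof. by rewrite -dot_delta (le_trans (normc_dot_le _ _))// l2norm_delta mulr1. Qed.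

Lemma l2sumE (I : Type) (s : seq I) (F : I -> H) x :
  (\sum_(i <- s) F i) x = \sum_(i <- s) F i x.
Proof. by apply: (big_ind2 (fun (a : H) b => a x = b)) => // a ? b ? <- <-. Qed.

Lemma l2restrictE A (f : G -> R[i]) : l2restrict A f = \sum_(x <- A) f x *: delta x.
Proof.
apply: l2E; apply/funext => y.
rewrite l2sumE; transitivity (restrict A f y) => //; rewrite /restrict; case: ifPn => yA.
  rewrite (big_fsetD1 y yA) l2ZE deltaE eqxx mulr1 big_seq big1; first by rewrite [RHS]addr0.
  move=> x.
  by rewrite !inE => /andP[/negbTE xy _]; rewrite l2ZE deltaE eq_sym xy mulr0.
rewrite big_seq big1// => x xA; rewrite l2ZE deltaE.
by case: eqP => [E|]; [move: yA; rewrite E xA | rewrite mulr0].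
Qed.

Lemma dot_suml (I : Type) (s : seq I) (F : I -> H) g :
  l2dot (\sum_(i <- s) F i) g = \sum_(i <- s) l2dot (F i) g.
Proof.
elim: s => [|i s IH]; last by rewrite !big_cons dotDl IH.
by rewrite !big_nil -(scale0r (0 : H)) dotZl mul0r.
Qed.

Lemma linear_combination (Q : H -> H) (s : seq G) (c : G -> R[i]) (F : G -> H) :
  linear Q -> Q (\sum_(u <- s) c u *: F u) = \sum_(u <- s) c u *: Q (F u).
Proof.
move=> Qlin; have Q0 : Q 0 = 0.
  by have := Qlin (-1) 0 0; rewrite scaler0 addr0 scaleN1r addNr.
elim: s => [|u s IH]; first by rewrite !big_nil.
by rewrite !big_cons Qlin IH.
Qed.

Lemma D0P f : D0 f <-> exists A : {fset G}, forall x, x \notin A -> f x = 0.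
Proof.
split=> [/finite_fsetP[A fA]|[A fA]].
  exists A => x; apply: contraNeq => fx.
  by have : [set x | f x != 0] x by []; rewrite fA.
apply: (@sub_finite_set _ _ [set` A]) => // x /=; apply: contraNT => /fA ->.
by rewrite eqxx.
Qed.

Lemma D0_fset (f : G -> R[i]) : finite_set [set x | f x != 0] ->
  exists A : {fset G}, forall x, x \notin A -> f x = 0.
Proof.
move=> /finite_fsetP[A fA]; exists A => x; apply: contraNeq => fx.
by have : [set x | f x != 0] x by []; rewrite fA.
Qed.

Lemma D0_l2restrict A (f : G -> R[i]) : D0 (l2restrict A f).
Proof. by apply/D0P; exists A => x; rewrite /= /restrict => /negbTE ->. Qed.

Lemma D0_delta x : D0 (delta x). Proof. exact: D0_l2restrict. Qed.

Lemma D0_lin c f g : D0 f -> D0 g -> D0 (c *: f + g).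
Proof.
move=> /D0P[A fA] /D0P[B gB]; apply/D0P; exists (A `|` B)%fset => x.
by rewrite inE negb_or => /andP[/fA + /gB]; rewrite !l2_coordE => -> ->; rewrite mulr0 addr0.
Qed.

Lemma D0_0 : D0 (0 : H).
Proof. by apply/D0P; exists fset0. Qed.

Lemma D0_add f g : D0 f -> D0 g -> D0 (f + g).
Proof. by rewrite -{2}(scale1r f); exact: D0_lin. Qed.

Lemma D0_scale c f : D0 f -> D0 (c *: f).
Proof. by move=> h; rewrite -(addr0 (c *: f)); apply: D0_lin => //; exact: D0_0. Qed.

Lemma D0_opp f : D0 f -> D0 (- f).
Proof. by rewrite -scaleN1r; exact: D0_scale. Qed.

Lemma D0_sum (I : Type) (s : seq I) (F : I -> H) : (forall i, D0 (F i)) ->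
  D0 (\sum_(i <- s) F i).
Proof. by move=> h; elim/big_ind: _ => //; [exact: D0_0 | exact: D0_add]. Qed.

Lemma l2restrict_approx f (e : R) : 0 < e ->
  exists A : {fset G}, '|f - l2restrict A f| <= e.
Proof.
move=> e0; have := sqr_l2norm (l2_square_summable f) => Ef.
have : (('|f| ^+ 2)%:E - (e ^+ 2)%:E < sqnorm f)%E.
  by rewrite Ef -EFinB lte_fin ltrBlDr ltrDl exprn_gt0.
move=> /ereal_sup_gt[_ [X /fsets_fset[A ->] <-]].
rewrite fsbig_finite//= set_fsetK sumEFin -EFinB lte_fin => hA.
exists A; rewrite -(@ler_pXn2r _ 2)// ?nnegrE ?l2norm_ge0// ?ltW//.
rewrite (sqr_norml2B f (l2restrict A f)).
have -> : Re (l2dot f (l2restrict A f)) = \sum_(x <- A) normc (f x) ^+ 2.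
  rewrite l2restrictE dotC dot_suml rmorph_sum/=.
  rewrite [in LHS](_ : \sum_(_ <- _) _ = (\sum_(x <- A) normc (f x) ^+ 2)%:C%C)//.
  rewrite rmorph_sum; apply: eq_bigr => x _.
  by rewrite -dotC dotZr dot_delta mulrC mulc_conj.
have -> : '|l2restrict A f| ^+ 2 = \sum_(x <- A) normc (f x) ^+ 2.
  apply: EFin_inj; rewrite -sqr_l2norm; last exact: l2_square_summable.
  rewrite (@sqnorm_fset _ A).
    by congr EFin; apply: eq_big_seq => x xA; rewrite /= /restrict xA.
  by move=> x; rewrite /= /restrict => /negbTE ->.
set S := \sum_(_ <- _) _ in hA *; lra.
Qed.

(** * Completeness *)

(** Coordinatewise limits exist because the real line is complete. The finite
    partial sums of the squared distances to them inherit the Cauchy bound, which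
    puts the limit in the space and gives convergence in norm. *)
Lemma l2_complete (u : nat -> H) :
  (forall e : R, 0 < e -> exists N, forall m n, (N <= m)%N -> (N <= n)%N ->
     '|u m - u n| <= e) ->
  exists v : H, forall e : R, 0 < e -> exists N, forall n, (N <= n)%N -> '|u n - v| <= e.
Proof.
move=> cu.
have coord (p : R[i] -> R) : (forall a b, p (a - b) = p a - p b) ->
    (forall a, `|p a| <= normc a) ->
    exists q : G -> R, forall x, (fun n => p (u n x)) @ \oo --> q x.
  move=> pB ple.
  have cc x : exists l : R, (fun n => p (u n x)) @ \oo --> l.
    have cc : cvgn (fun n => p (u n x)).
      apply: real_cauchy_cvg => e /cu[N hN]; exists N => m n Nm Nn.
      rewrite -pB (le_trans (ple _))// (le_trans _ (hN m n Nm Nn))//.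
      by rewrite -l2BE normc_coord_le.
    by exists (lim ((fun n => p (u n x)) @ \oo)).
  by have [q hq] := boolp.choice cc; exists q.
have [q hq] := coord Re (fun a b => etrans (Re_add a (- b)) (congr1 _ (Re_opp b))) (@normc_Re R).
have [r hr] := coord Im (fun a b => etrans (Im_add a (- b)) (congr1 _ (Im_opp b))) (@normc_Im R).
pose v x : R[i] := (q x +i* r x)%C.
have bnd (e : R) N n (A : {fset G}) : 0 < e ->
    (forall m, (N <= m)%N -> '|u n - u m| <= e) ->
    \sum_(x <- A) normc (u n x - v x) ^+ 2 <= e ^+ 2.
  move=> e0 hN.
  have : (fun m => \sum_(x <- A) normc (u n x - u m x) ^+ 2) @ \oo -->
      \sum_(x <- A) normc (u n x - v x) ^+ 2.
    apply: cvg_big => [|x _].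
      exact: add_continuous.
    rewrite normc_sq !Re_add !Im_add !Re_opp !Im_opp; under eq_cvg do rewrite normc_sq !Re_add !Im_add !Re_opp !Im_opp.
    apply: cvgD; rewrite expr2; under eq_cvg do rewrite expr2.
      by apply: cvgM; apply: cvgB; (exact: cvg_cst || exact: hq).
    by apply: cvgM; apply: cvgB; (exact: cvg_cst || exact: hr).
  move=> h; rewrite -(cvg_lim _ h)//; apply: limr_le; first by apply/cvg_ex; eexists; exact: h.
  exists N => // m /= Nm.
  apply: (@le_trans _ _ ('|u n - u m| ^+ 2)); last first.
    by rewrite ler_pXn2r ?nnegrE ?l2norm_ge0 ?(ltW e0)// hN.
  by rewrite -lee_fin -sqr_l2norm; [exact: sqnorm_ge_fset|exact: l2_square_summable].
have dif (e : R) n N : 0 < e ->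
    (forall m, (N <= m)%N -> '|u n - u m| <= e) -> (sqnorm (fun x => (u n x - v x)%R) <= (e ^+ 2)%:E)%E.
  by move=> e0 h; apply: sqnorm_le_ub => A; exact: bnd h.
have [N hN] := cu 1 ltr01.
have vP : v \in l2_pred (G := G).
  apply/asboolP.
  have -> : v = (l2fun (u N) : G -> R[i]) + (-1) *: (fun x => u N x - v x : R[i]).
    by apply/funext => x; rewrite scaleN1r /= -[RHS]/(u N x - (u N x - v x)) subKr.
  apply: square_summableD; first exact: l2_square_summable.
  apply: square_summableZ; apply: le_lt_trans (dif 1 N N ltr01 _) (ltry _).
  by move=> m Nm; exact: hN.
exists (L2 vP) => e e0; have [M hM] := cu _ e0; exists M => n Mn.
have := dif e n M e0 (fun m => hM n m Mn).
rewrite -[fun x => _]/(l2fun (u n - L2 vP)) sqr_l2norm; last exact: l2_square_summable.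
by rewrite lee_fin ler_pXn2r// ?nnegrE ?l2norm_ge0 ?(ltW e0).
Qed.
End HilbertSpace.
Arguments delta {R G} x.
#[local] Hint Resolve l2_square_summable : core.

(** * Symmetric operators given by their graphs *)

Section Graphs.
Variables (R : realType) (G : choiceType).
Local Notation H := (l2 R G).
Local Notation Re := (@complex.Re R).
Local Notation Im := (@complex.Im R).
Local Notation "''|' f |" := (l2norm (l2fun f)) (at level 0, f at level 99, format "''|' f |").
Implicit Types (f g h xi : H) (c z : R[i]) (S T B : set (H * H)) (p q : H * H).

Lemma l2_ball f (e : R) g : ball f e%:C%C g <-> '|f - g| < e.
Proof. by rewrite -ball_normE /ball_/= [ `|_| ]/(l2norm _)%:C%C ltcR. Qed.

Lemma ltC_real (e : R[i]) : 0 < e -> exists2 r : R, 0 < r & e = r%:C%C.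
Proof.
by case: e => a b; rewrite ltcE/= => /andP[/eqP -> a0]; exists a.
Qed.

(** Closure in the product topology of the two norms, in terms of the real norm. *)
Lemma closure_graphP T p : closure T p <-> forall e : R, 0 < e ->
  exists q, [/\ T q, '|p.1 - q.1| < e & '|p.2 - q.2| < e].
Proof.
split.
  move=> clp e e0.
  have e0' : 0 < e%:C%C :> R[i] by rewrite ltcR.
  have [q [Tq [q1 q2]]] := clp _ (nbhsx_ballx p _ e0').
  by exists q; split => //; apply/l2_ball.
move=> h U /nbhs_ballP[_/posnumP[e] eU].
have [r r0 er] := ltC_real [gt0 of e%:num].
have [q [Tq q1 q2]] := h _ r0; exists q; split => //; apply: eU.
by split; rewrite er; apply/l2_ball.
Qed.

Lemma denseP (D : set H) :
  (forall f (e : R), 0 < e -> exists2 g, D g & '|f - g| < e) -> dense D.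
Proof.
move=> h O [f Of] oO; have /nbhs_ballP[_/posnumP[e] eO] := open_nbhs_nbhs (conj oO Of).
have [r r0 er] := ltC_real [gt0 of e%:num].
have [g Dg fg] := h f _ r0; exists g; split => //; apply: eO.
by rewrite er; apply/l2_ball.
Qed.

(** The orthogonality relations that define the adjoint are continuous, so they
    pass to closures. *)
Lemma adjoint_closure S T : T `<=` adjoint S -> closure T `<=` adjoint S.
Proof.
move=> TS p /closure_graphP clp u v Suv; apply/eqP; rewrite -subr_eq0; apply/eqP.
apply: normc_small => e e0; have k0 : 0 < 1 + '|u| + '|v|.
  by rewrite -addrA ltr_pwDl// addr_ge0// l2norm_ge0.
have [q [Tq h1 h2]] := clp _ (divr_gt0 e0 k0).
have -> : l2dot v p.1 - l2dot u p.2 = l2dot v (p.1 - q.1) - l2dot u (p.2 - q.2).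
  by rewrite !dotDr !dotNr (TS _ Tq _ _ Suv); ring.
rewrite (le_trans (normcD _ _))// normc_opp.
rewrite (le_trans (lerD (normc_dot_le _ _) (normc_dot_le _ _)))//.
set k := 1 + _ + _ in k0 h1 h2; set d := e / k in h1 h2.
have -> : e = d * k by rewrite /d divfK// gt_eqF.
have := l2norm_ge0 u; have := l2norm_ge0 v.
have : 0 < d by exact: divr_gt0.
rewrite /k; nra.
Qed.

(** A single inclusion of graphs says that <T f, g> = <f, T g> on the domain. *)
Definition symmetric_graph T := T `<=` adjoint T.

Lemma adjoint_swap S T : T `<=` adjoint S -> S `<=` adjoint T.
Proof.
move=> TS p Sp u v Tuv; rewrite dotC [RHS]dotC.
by congr (_^*%C); rewrite -(TS _ Tuv p.1 p.2)// -surjective_pairing.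
Qed.

Lemma closure_symmetric T : symmetric_graph T -> symmetric_graph (closure T).
Proof.
by move=> sT; apply: adjoint_closure; apply: adjoint_swap; exact: adjoint_closure.
Qed.

Lemma closure_linear T (c : R[i]) p q :
  (forall d p q, T p -> T q -> T (d *: p + q)) ->
  closure T p -> closure T q -> closure T (c *: p + q).
Proof.
move=> lT /closure_graphP hp /closure_graphP hq; apply/closure_graphP => e e0.
have k0 : 0 < 1 + normc c by rewrite ltr_pwDl// normc_ge0.
set d := e / 2 / (1 + normc c); have d0 : 0 < d by rewrite !divr_gt0.
have [p' [Tp p1 p2]] := hp _ d0; have [q' [Tq q1 q2]] := hq (e / 2) ltac:(lra).
have dk : d * (1 + normc c) = e / 2 by rewrite /d divfK// gt_eqF.
exists (c *: p' + q'); split; first exact: lT.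
  have -> : (c *: p + q).1 - (c *: p' + q').1 = c *: (p.1 - p'.1) + (q.1 - q'.1).
    by rewrite scalerBr opprD addrACA.
  rewrite (le_lt_trans (norml2D _ _))// norml2Z.
  have := normc_ge0 c; have := l2norm_ge0 (p.1 - p'.1); nra.
have -> : (c *: p + q).2 - (c *: p' + q').2 = c *: (p.2 - p'.2) + (q.2 - q'.2).
  by rewrite scalerBr opprD addrACA.
rewrite (le_lt_trans (norml2D _ _))// norml2Z.
have := normc_ge0 c; have := l2norm_ge0 (p.2 - p'.2); nra.
Qed.

(** For a symmetric operator the numbers <Tf, f> are real, so the imaginary part of
    <(z - T) f, f> is Im z times the squared norm of f. *)
Lemma symmetric_lower_bound T z p : symmetric_graph T -> T p ->
  `|Im z| * '|p.1| <= '|z *: p.1 - p.2|.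
Proof.
move=> sT Tp.
have [p0|p0] := eqVneq '|p.1| 0; first by rewrite p0 mulr0 l2norm_ge0.
have pp : 0 < '|p.1| by rewrite lt_neqAle eq_sym p0 l2norm_ge0.
have real : Im (l2dot p.2 p.1) = 0.
  have /(congr1 Im) : l2dot p.2 p.1 = (l2dot p.2 p.1)^*%C.
    by rewrite -dotC; apply: (sT _ Tp); rewrite -surjective_pairing.
  by case: (l2dot _ _) => a b /= h; lra.
rewrite -(ler_pM2r pp); apply: le_trans (normc_dot_le _ _).
apply: le_trans (normc_Im _).
rewrite dotDl dotNl dotZl dotff Im_add Im_opp real oppr0 addr0 Im_mul/= mulr0 add0r.
by rewrite normrM [ `| _ ^+ 2| ]ger0_norm ?sqr_ge0// expr2 mulrA.
Qed.

(** Linearity of the map (f, g) |-> z f - g on graphs. *)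
Lemma shiftB z f f' g g' :
  z *: (f - f') - (g - g') = (z *: f - g) - (z *: f' - g').
Proof. by rewrite scalerBr !opprD !opprK addrACA. Qed.

(** What self-adjointness means for resolvents: z - B is onto for every
    non-real z. Both the closures studied below and the identity, which replaces
    them on the exceptional null set, have this property. *)
Record full_symmetric B : Prop := FullSymmetric {
  full_symmetric_operator : is_operator B ;
  full_symmetric_graph : symmetric_graph B ;
  full_symmetric_surj : forall z, Im z != 0 -> forall xi, exists2 p, B p & z *: p.1 - p.2 = xi }.

Lemma full_symmetric_unique B z p q : symmetric_graph B -> is_operator B -> Im z != 0 -> B p -> B q ->
  z *: p.1 - p.2 = z *: q.1 - q.2 -> p.1 = q.1.
Proof.
move=> sB [_ lB _] z0 Bp Bq e; apply/eqP; rewrite -subr_eq0; apply/eqP.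
have := symmetric_lower_bound z sB (lB (-1) q p Bq Bp).
rewrite (_ : (-1 *: q + p).1 = p.1 - q.1); last by rewrite /= scaleN1r addrC.
rewrite (_ : (-1 *: q + p).2 = p.2 - q.2); last by rewrite /= scaleN1r addrC.
rewrite shiftB e subrr norml20 pmulr_rle0 ?normr_gt0// => h.
by apply: norml2_eq0; apply/eqP; rewrite eq_le h l2norm_ge0.
Qed.

(** If (f, g) is in the adjoint, solve (i - B) q = i f - g in B. The difference
    of (f, g) and q is an eigenvector of the adjoint for i, so it is orthogonal
    to the range of - i - B, which is everything. *)
Lemma full_symmetric_self_adjoint B : full_symmetric B -> dense (dom B) ->
  self_adjoint B.
Proof.
case=> [[B0 lB uB] sB surjB] dB; split=> //.
apply/seteqP; split; last exact: sB.
move=> p adjp.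
have i1 : Im 'i%C != 0 by rewrite /= oner_eq0.
have [q Bq qE] := surjB _ i1 ('i%C *: p.1 - p.2).
have d2 : p.2 - q.2 = 'i%C *: (p.1 - q.1).
  by apply/esym/eqP; rewrite -subr_eq0 shiftB qE subrr.
have d1 : p.1 - q.1 = 0.
  have ni : Im (- 'i%C) != 0 by rewrite /= oppr_eq0 oner_eq0.
  have [r Br rE] := surjB _ ni (p.1 - q.1).
  apply: norml2_eq0; apply/eqP; rewrite -sqrf_eq0; apply/eqP/complexI.
  rewrite -dotff -{1}rE dotDl dotZl dotNl.
  have -> : l2dot r.2 (p.1 - q.1) = l2dot r.1 (p.2 - q.2).
    rewrite !dotDr !dotNr (adjp r.1 r.2) -?surjective_pairing//.
    by rewrite (sB _ Bq r.1 r.2) -?surjective_pairing.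
  rewrite d2 dotZr; set d := l2dot _ _.
  have -> : ('i%C)^*%C = - 'i%C :> R[i] by apply/eqP; rewrite eq_complex /= oppr0 !eqxx.
  by rewrite subrr.
rewrite d1 scaler0 in d2.
have -> : p = q; last by [].
move: d1 d2 => /eqP + /eqP; rewrite !subr_eq0 => /eqP d1 /eqP d2.
by rewrite (surjective_pairing p) (surjective_pairing q) d1 d2.
Qed.

(** * Resolvents *)

Lemma resolventP B z xi : full_symmetric B -> Im z != 0 ->
  exists2 g, B (resolvent B z xi, g) & z *: resolvent B z xi - g = xi.
Proof.
move=> fB z0; have [p Bp pE] := full_symmetric_surj fB z0 xi.
have [|g Bg gE] := @getPex _ [set f | exists2 g, B (f, g) & z *: f - g = xi].
  by exists p.1; exists p.2 => //; rewrite -surjective_pairing.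
by exists g.
Qed.

Lemma resolvent_le B z xi : full_symmetric B -> Im z != 0 ->
  '|resolvent B z xi| <= `|Im z|^-1 * '|xi|.
Proof.
move=> fB z0; have [g Bg gE] := resolventP xi fB z0.
have : `|Im z| * '|resolvent B z xi| <= '|z *: resolvent B z xi - g|.
  exact: symmetric_lower_bound (full_symmetric_graph fB) Bg.
by rewrite gE ler_pdivlMl// normr_gt0.
Qed.

Lemma resolvent_uniq B z f g : full_symmetric B -> Im z != 0 -> B (f, g) ->
  f = resolvent B z (z *: f - g).
Proof.
move=> fB z0 Bp; have [h Bh hE] := resolventP (z *: f - g) fB z0.
exact: (full_symmetric_unique (full_symmetric_graph fB) (full_symmetric_operator fB) z0 Bp Bh (esym hE)).
Qed.

Lemma resolvent_linear B z : full_symmetric B -> Im z != 0 -> linear (resolvent B z).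
Proof.
move=> fB z0 c xi eta; have [_ lB _] := full_symmetric_operator fB.
have [g Bg gE] := resolventP xi fB z0; have [h Bh hE] := resolventP eta fB z0.
rewrite [RHS](resolvent_uniq fB z0 (lB c _ _ Bg Bh)).
congr resolvent; rewrite -[in LHS]gE -[in LHS]hE.
by rewrite !scalerBr scalerDr !scalerA (mulrC c) opprD addrACA.
Qed.

Lemma resolvent_bounded B z : full_symmetric B -> Im z != 0 ->
  bounded_operator (resolvent B z).
Proof.
move=> fB z0; split; first exact: resolvent_linear.
exists `|Im z|^-1 => xi.
by rewrite [ `|_| ]/(l2norm _)%:C%C [ `|xi| ]/(l2norm _)%:C%C -rmorphM lecR resolvent_le.
Qed.

Lemma full_symmetric_resolvent_set B z : full_symmetric B -> Im z != 0 ->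
  resolvent_set B z.
Proof.
move=> fB z0; split; last exact: resolvent_bounded.
move=> xi; have [g Bg gE] := resolventP xi fB z0.
exists (resolvent B z xi); split; first by exists g.
by move=> f [h Bh <-]; rewrite -(resolvent_uniq fB z0 Bh).
Qed.

(** Resolvent identity, in the form of a Lipschitz bound in the spectral
    parameter. *)
Lemma resolvent_lipschitz B z w xi : full_symmetric B -> Im z != 0 -> Im w != 0 ->
  '|resolvent B w xi - resolvent B z xi| <=
    `|Im w|^-1 * (normc (z - w) * '|resolvent B z xi|).
Proof.
move=> fB z0 w0; have [g Bg gE] := resolventP xi fB z0.
rewrite [X in _ - X](resolvent_uniq fB w0 Bg) -norml2Z.
have -> : resolvent B w xi - resolvent B w (w *: resolvent B z xi - g) =
    resolvent B w ((z - w) *: resolvent B z xi).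
  rewrite addrC -scaleN1r -(resolvent_linear fB w0); congr resolvent.
  have zE : z *: resolvent B z xi = xi + g by apply/eqP; rewrite -subr_eq gE.
  by rewrite scaleN1r addrC scalerBl zE opprB addrA.
exact: resolvent_le.
Qed.

Lemma full_symmetric_id : full_symmetric (@id_operator R G).
Proof.
split.
- by split => [//|c p q|f g g']; rewrite /id_operator /= => -> ->.
- by move=> p pE u v; rewrite /id_operator/= in pE * => ->; rewrite pE.
- move=> z z0 xi.
  have z1 : z - 1 != 0.
    by apply: contraNneq z0 => /eqP; rewrite subr_eq0 => /eqP ->.
  exists ((z - 1)^-1 *: xi, (z - 1)^-1 *: xi) => //=.
  by rewrite -[X in _ - X]scale1r -scalerBl scalerA divff// scale1r.
Qed.

(** * Density of the range *)

(** The closure of the range of z - T, in epsilon form. *)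
Definition approx_range T z : set H :=
  [set xi | forall e : R, 0 < e -> exists2 p, T p & '|z *: p.1 - p.2 - xi| <= e].

Lemma approx_range_lin T z c xi eta :
  (forall d p q, T p -> T q -> T (d *: p + q)) ->
  approx_range T z xi -> approx_range T z eta -> approx_range T z (c *: xi + eta).
Proof.
move=> lT h1 h2 e e0.
have k0 : 0 < 1 + normc c by rewrite ltr_pwDl// normc_ge0.
set d := e / 2 / (1 + normc c); have d0 : 0 < d by rewrite !divr_gt0.
have dk : d * (1 + normc c) = e / 2 by rewrite /d divfK// gt_eqF.
have [p Tp hp] := h1 _ d0; have [q Tq hq] := h2 (e / 2) ltac:(lra).
exists (c *: p + q); first exact: lT.
have -> : z *: (c *: p + q).1 - (c *: p + q).2 - (c *: xi + eta) =
    c *: (z *: p.1 - p.2 - xi) + (z *: q.1 - q.2 - eta).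
  rewrite /= !scalerBr scalerDr !scalerA (mulrC c) !opprD.
  by rewrite [RHS]addrACA; congr (_ + _); rewrite addrACA.
rewrite (le_trans (norml2D _ _))// norml2Z.
have := normc_ge0 c; have := l2norm_ge0 (z *: p.1 - p.2 - xi); nra.
Qed.

Lemma approx_range_all T z : T (0, 0) ->
  (forall d p q, T p -> T q -> T (d *: p + q)) ->
  (forall x, approx_range T z (delta x)) -> forall xi, approx_range T z xi.
Proof.
move=> T0 lT hd xi e e0.
have [A hA] := l2restrict_approx xi (e := e / 2) ltac:(lra).
have : approx_range T z (l2restrict A xi).
  rewrite l2restrictE; elim/big_rec: _ => [|x eta _ IH].
    by move=> d d0; exists (0, 0) => //=; rewrite scaler0 !subr0 norml20 ltW.
  exact: approx_range_lin.
move=> /(_ (e / 2) ltac:(lra))[p Tp hp]; exists p => //.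
have -> : z *: p.1 - p.2 - xi = (z *: p.1 - p.2 - l2restrict A xi) - (xi - l2restrict A xi).
  by rewrite opprB [RHS]addrA subrK.
by rewrite (le_trans (norml2B _ _))// [leRHS]splitr lerD.
Qed.

(** Density of the range is transported from w to a nearby z: an approximate
    solution p at w satisfies |p| <= (|xi| + 1) / |Im w|, so replacing w by z costs
    at most |z - w| times this bound. *)
Lemma approx_range_near T z : symmetric_graph T -> Im z != 0 ->
  (forall e : R, 0 < e -> exists w, [/\ normc (z - w) <= e, Im w != 0 &
     forall xi, approx_range T w xi]) ->
  forall xi, approx_range T z xi.
Proof.
move=> sT z0 hw xi e e0.
have y0 : 0 < `|Im z| by rewrite normr_gt0.
set k := `|Im z| / 2; have k0 : 0 < k by rewrite /k; lra.
have kE : k + k = `|Im z| by rewrite /k; lra.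
set M := ('|xi| + 1) / k; have M0 : 0 < M.
  by rewrite divr_gt0// ltr_wpDl// l2norm_ge0.
set d := Num.min k (e / 2 / M).
have d0 : 0 < d by rewrite lt_min k0 (divr_gt0 _ M0)// divr_gt0.
have [w [wd w0 hwxi]] := hw _ d0.
have wk : k <= `|Im w|.
  have := normc_Im (z - w); rewrite Im_add Im_opp => h.
  have : normc (z - w) <= k by rewrite (le_trans wd)// /d ge_min lexx.
  have := ler_distD (Im w) (Im z) 0; rewrite !subr0; lra.
have e1 : 0 < Num.min 1 (e / 2) by rewrite lt_min ltr01/=; lra.
have [p Tp hp] := hwxi xi _ e1; exists p => //.
have hp1 : '|w *: p.1 - p.2 - xi| <= 1 by rewrite (le_trans hp)// ge_min lexx.
have hp2 : '|w *: p.1 - p.2 - xi| <= e / 2 by rewrite (le_trans hp)// ge_min lexx orbT.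
have pM : '|p.1| <= M.
  rewrite ler_pdivlMr// mulrC; apply: (@le_trans _ _ (`|Im w| * '|p.1|)).
    by rewrite ler_wpM2r// l2norm_ge0.
  rewrite (le_trans (symmetric_lower_bound w sT Tp))//.
  have -> : w *: p.1 - p.2 = xi + (w *: p.1 - p.2 - xi) by rewrite [RHS]addrC subrK.
  by rewrite (le_trans (norml2D _ _))//; lra.
have -> : z *: p.1 - p.2 - xi = (z - w) *: p.1 + (w *: p.1 - p.2 - xi).
  by rewrite scalerBl !addrA subrK.
rewrite (le_trans (norml2D _ _))// norml2Z.
have : normc (z - w) * '|p.1| <= d * M by rewrite ler_pM ?normc_ge0 ?l2norm_ge0.
have : d * M <= e / 2 by rewrite -ler_pdivlMr// ge_min lexx orbT.
lra.
Qed.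

(** The lower bound turns approximate solutions of (z - T) f = xi into a Cauchy
    sequence. *)
Lemma closure_surj T z : symmetric_graph T ->
  (forall d p q, T p -> T q -> T (d *: p + q)) ->
  Im z != 0 -> (forall xi, approx_range T z xi) ->
  forall xi, exists2 p, closure T p & z *: p.1 - p.2 = xi.
Proof.
move=> sT lT z0 hz xi.
have y0 : 0 < `|Im z| by rewrite normr_gt0.
have /boolp.choice[p hp] : forall n : nat, exists p, T p /\ '|z *: p.1 - p.2 - xi| <= n.+1%:R^-1.
  by move=> n; have [|p Tp hp] := hz xi n.+1%:R^-1; [rewrite invr_gt0 | exists p].
have small (e : R) : 0 < e -> exists N, forall n, (N <= n)%N -> n.+1%:R^-1 <= e.
  move=> e0; have := @near_infty_natSinv_lt R (PosNum e0) => -[N _ hN].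
  by exists N => n Nn; apply/ltW/hN.
have [|v hv] := @l2_complete R G (fun n => (p n).1).
  move=> e e0; have [|N hN] := small (e * `|Im z| / 2); first by rewrite !mulr_gt0.
  exists N => m n Nm Nn; rewrite -(ler_pM2l y0).
  have := symmetric_lower_bound z sT (lT (-1) _ _ (hp n).1 (hp m).1).
  rewrite (_ : (-1 *: p n + p m).1 = (p m).1 - (p n).1); last by rewrite /= scaleN1r addrC.
  rewrite (_ : (-1 *: p n + p m).2 = (p m).2 - (p n).2); last by rewrite /= scaleN1r addrC.
  move=> h; rewrite (le_trans h)// shiftB.
  have -> : z *: (p m).1 - (p m).2 - (z *: (p n).1 - (p n).2) =
    (z *: (p m).1 - (p m).2 - xi) - (z *: (p n).1 - (p n).2 - xi).
    by rewrite [in RHS](opprB _ xi) [RHS]addrA subrK.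
  rewrite (le_trans (norml2B _ _))//.
  rewrite mulrC [leRHS]splitr lerD//.
    exact: le_trans (hp m).2 (hN _ Nm).
  exact: le_trans (hp n).2 (hN _ Nn).
exists (v, z *: v - xi); last exact: subKr.
apply/closure_graphP => e e0.
have k0 : 0 < 2 * (1 + normc z) by rewrite mulr_gt0// ltr_pwDl// normc_ge0.
set d := e / (2 * (1 + normc z)); have d0 : 0 < d by exact: divr_gt0.
have dk : d * (2 * (1 + normc z)) = e by rewrite /d divfK// gt_eqF.
have [N hN] := hv _ d0; have [M hM] := small _ d0.
pose n := maxn N M; exists (p n).
have := hN n (leq_maxl _ _); rewrite norml2_distC => h1.
have h2 := le_trans (hp n).2 (hM n (leq_maxr _ _)).
split; first exact: (hp n).1.
  by rewrite (le_lt_trans h1)//; have := normc_ge0 z; nra.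
have -> : (v, z *: v - xi).2 - (p n).2 = z *: (v - (p n).1) + (z *: (p n).1 - (p n).2 - xi).
  by rewrite /= scalerBr !addrA subrK -!addrA [- xi + _]addrC.
rewrite (le_lt_trans (norml2D _ _))// norml2Z.
have := normc_ge0 z; have := l2norm_ge0 (v - (p n).1); nra.
Qed.

(** A symmetric operator that is defined on all point masses is closable, since
    its adjoint then determines the coordinates of g from f. *)
Lemma closure_full_symmetric T : is_operator T -> symmetric_graph T ->
  (forall x, dom T (delta x)) ->
  (forall z, Im z != 0 -> forall xi, approx_range T z xi) ->
  full_symmetric (closure T).
Proof.
move=> [T0 lT uT] sT dT hz; split.
- split; first exact: subset_closure.
    by move=> c p q; exact: closure_linear.
  move=> f g g' h h'; apply: l2E; apply/funext => x.
  have [u Tu] := dT x.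
  rewrite -!dot_delta !(dotC _ (delta x)); congr (_^*%C).
  have /adjoint_closure aT := sT.
  by rewrite -(aT _ h _ _ Tu) -(aT _ h' _ _ Tu).
- exact: closure_symmetric.
- by move=> z z0 xi; apply: closure_surj => //; exact: hz.
Qed.

End Graphs.

(** * Operators with hermitian kernels *)

Section KernelOperator.
Variables (R : realType) (G : choiceType).
Local Notation H := (l2 R G).
Local Notation "''|' f |" := (l2norm (l2fun f)) (at level 0, f at level 99, format "''|' f |").
Implicit Types (f g : H) (k : G -> G -> R[i]).

Lemma l2_ofP (f : G -> R[i]) : square_summable f -> f \in l2_pred (G := G).
Proof. by move=> ?; apply/asboolP. Qed.

Definition l2_of (f : G -> R[i]) (ss : square_summable f) : H := L2 (l2_ofP ss).

(** Any finite set containing the support may serve as summation range. *)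
Lemma kernel_action_fset k (f : G -> R[i]) (A : {fset G}) x :
  (forall y, y \notin A -> f y = 0) ->
  kernel_action k f x = \sum_(y <- A) k x y * f y.
Proof. by move=> fA; apply: fsbigTE => y /fA ->; rewrite mulr0. Qed.

Variable k : G -> G -> R[i].
Hypothesis kss : forall y, square_summable (k ^~ y).

Lemma kernel_action_ex f : D0 f ->
  exists g : H, D0 f /\ l2fun g = kernel_action k f.
Proof.
move=> Df; have [A fA] := D0_fset Df.
exists (\sum_(y <- A) f y *: l2_of (kss y)); split=> //; apply/funext => x.
rewrite (kernel_action_fset _ _ fA) l2sumE; apply: eq_bigr => y _.
by rewrite l2ZE mulrC.
Qed.

Lemma kernel_action_square_summable f : D0 f -> square_summable (kernel_action k f).
Proof. by move=> /kernel_action_ex[g [_ <-]]; exact: l2_square_summable. Qed.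

Lemma kernel_action_linear (c : R[i]) (f g : H) : D0 f -> D0 g ->
  kernel_action k (c *: f + g) = fun x => c * kernel_action k f x + kernel_action k g x.
Proof.
move=> /D0P[A fA] /D0P[B gB]; apply/funext => x.
have AB (y : G) : y \notin (A `|` B)%fset -> y \notin A /\ y \notin B.
  by rewrite inE negb_or => /andP.
rewrite !(@kernel_action_fset _ _ (A `|` B)%fset).
- rewrite mulr_sumr -big_split/=; apply: eq_bigr => y _.
  by rewrite -[(_ + _) y]/(c * f y + g y); ring.
- by move=> y /AB[_ /gB].
- by move=> y /AB[/fA].
- by move=> y /AB[yA yB]; rewrite -[LHS]/(c * f y + g y) fA// gB// mulr0 addr0.
Qed.

Lemma kernel_operator_is_operator : is_operator (kernel_operator k).
Proof.
split.
- split; first exact: D0_0.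
  by apply/funext => x; rewrite (@kernel_action_fset _ _ fset0) ?big_nil.
- move=> c p q [Dp pE] [Dq qE]; split; first exact: D0_lin.
  by rewrite kernel_action_linear// -pE -qE.
- by move=> f g g' [_ /= gE] [_ /= gE']; apply: l2E; rewrite gE gE'.
Qed.

Lemma dom_kernel_operator f : D0 f -> dom (kernel_operator k) f.
Proof. by move=> Df; have [g gP] := kernel_action_ex Df; exists g. Qed.

Lemma dense_kernel_operator : dense (dom (kernel_operator k)).
Proof.
apply: denseP => f e e0; have [|A hA] := l2restrict_approx f (e := e / 2); first lra.
exists (l2restrict A f); first by apply: dom_kernel_operator; exact: D0_l2restrict.
by rewrite (le_lt_trans hA)//; lra.
Qed.

Lemma dot_fset f g (A : {fset G}) : (forall y, y \notin A -> f y = 0) ->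
  l2dot f g = \sum_(y <- A) f y * (g y)^*%C.
Proof.
move=> fA; apply: l2dot_eq; apply: has_sum_fin => y /fA ->.
by rewrite mul0r.
Qed.

Hypothesis kherm : forall x y, k x y = (k y x)^*%C.

Lemma symmetric_kernel_operator : symmetric_graph (kernel_operator k).
Proof.
move=> p [Dp pE] f g [Df gE] /=; rewrite /= in Dp pE Df gE.
have [A fA] := D0_fset Df; have [B pB] := D0_fset Dp.
rewrite (dot_fset _ fA) dotC (dot_fset _ pB) rmorph_sum/=.
rewrite gE pE.
transitivity (\sum_(x <- B) \sum_(y <- A) k x y * f y * (p.1 x)^*%C).
  apply: eq_bigr => x _; rewrite (kernel_action_fset _ _ fA) rmorphM/= conjcK mulrC.
  by rewrite mulr_suml.
rewrite exchange_big/=; apply: eq_bigr => y _.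
rewrite (kernel_action_fset _ _ pB) rmorph_sum mulr_sumr; apply: eq_bigr => x _.
by rewrite rmorphM/= -kherm; ring.
Qed.

Lemma kernel_essentially_self_adjoint :
  (forall z, complex.Im z != 0 -> forall xi, approx_range (kernel_operator k) z xi) ->
  essentially_self_adjoint (kernel_operator k) /\
  full_symmetric (closure (kernel_operator k)).
Proof.
move=> hz; have fsT : full_symmetric (closure (kernel_operator k)).
  apply: closure_full_symmetric => //.
  - exact: kernel_operator_is_operator.
  - exact: symmetric_kernel_operator.
  - by move=> x; apply: dom_kernel_operator; exact: D0_delta.
split=> //; split; [exact: kernel_operator_is_operator|exact: dense_kernel_operator|].
apply: full_symmetric_self_adjoint => //.
move=> O O0 oO; have [f [Of [g Tfg]]] := dense_kernel_operator O0 oO.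
by exists f; split=> //; exists g; exact: subset_closure.
Qed.

End KernelOperator.

(** * Polynomial approximation of a resolvent *)

Section Polynomial.
Variables (R : realType) (G : choiceType).
Local Notation H := (l2 R G).
Local Notation Re := (@complex.Re R).
Local Notation "''|' f |" := (l2norm (l2fun f)) (at level 0, f at level 99, format "''|' f |").
Variables (S : H -> H) (t M : R).
Implicit Types (xi : H).

(** With M at least the norm of S, damping (t ^ 2 + S ^ 2) lies between
    damping t ^ 2 > 0 and 1, so the step operator 1 - damping (t ^ 2 + S ^ 2) is
    a contraction and its Neumann series inverts t ^ 2 + S ^ 2. *)
Definition damping : R := (t ^+ 2 + M ^+ 2)^-1.

Definition damped_step (u : H) : H :=
  u - damping%:C%C *: ((t ^+ 2)%:C%C *: u + S (S u)).

Definition residual xi n : H := iter n damped_step xi.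

Definition neumann_sum xi n : H := damping%:C%C *: \sum_(j < n) residual xi j.

(** (i t - S)^-1 = (- i t - S) (t ^ 2 + S ^ 2)^-1, with the inverse on the right
    replaced by a partial sum of its Neumann series. *)
Definition poly_resolvent xi n : H :=
  (- (t%:C%C * 'i%C)) *: neumann_sum xi n - S (neumann_sum xi n).

Hypothesis t0 : t != 0.
Hypothesis Slin : linear S.
Hypothesis SD0 : forall f, D0 f -> D0 (S f).
Hypothesis Ssym : forall f g, D0 f -> D0 g -> l2dot (S f) g = l2dot f (S g).
Hypothesis M0 : 0 <= M.
Hypothesis Sle : forall f, D0 f -> '|S f| <= M * '|f|.

Let SD f g : S (f + g) = S f + S g.
Proof. by have := Slin 1 f g; rewrite !scale1r. Qed.
Let S0 : S 0 = 0.
Proof. by have := SD 0 0; rewrite addr0 => /eqP; rewrite -subr_eq subrr eq_sym => /eqP. Qed.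
Let SZ c f : S (c *: f) = c *: S f.
Proof. by have := Slin c f 0; rewrite !addr0 S0 addr0. Qed.
Let SN f : S (- f) = - S f.
Proof. by rewrite -(scaleN1r f) SZ scaleN1r. Qed.
Let t2 : 0 < t ^+ 2. Proof. by rewrite lt_neqAle sqr_ge0 andbT eq_sym sqrf_eq0. Qed.
Let tM0 : 0 < t ^+ 2 + M ^+ 2. Proof. by rewrite ltr_pwDl// sqr_ge0. Qed.
Let c0 : 0 < damping. Proof. by rewrite invr_gt0. Qed.
Let cE : damping * (t ^+ 2 + M ^+ 2) = 1.
Proof. by rewrite mulVf// gt_eqF. Qed.

Definition contraction_rate : R := 1 - damping * t ^+ 2.

Lemma contraction_rate_bound : 0 <= contraction_rate < 1.
Proof.
rewrite /contraction_rate; have := cE; have := sqr_ge0 M; have := c0; have := t2.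
by move: damping (t ^+ 2) (M ^+ 2) => c T N; nra.
Qed.

(** The cross term of the expanded square is - 2 rate damping |S u|^2, which
    dominates damping ^ 2 |S (S u)|^2 <= damping rate |S u|^2. *)
Lemma damped_step_le u : D0 u -> '|damped_step u| <= contraction_rate * '|u|.
Proof.
move=> Du; have /andP[a0 a1] := contraction_rate_bound.
have DS : D0 (S u) by exact: SD0.
have DSS : D0 (S (S u)) by exact: SD0.
have -> : damped_step u = contraction_rate%:C%C *: u - damping%:C%C *: S (S u).
  rewrite /damped_step scalerDr scalerA -rmorphM opprD addrA; congr (_ - _).
  by rewrite /contraction_rate rmorphB scalerBl scale1r.
rewrite -(@ler_pXn2r _ 2)// ?nnegrE ?mulr_ge0 ?l2norm_ge0//.
rewrite sqr_norml2B !norml2Z dotZl dotZr conjc_real !Re_realM !normc_real !ger0_norm ?(ltW c0)//.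
rewrite -(Ssym Du DS) dotff /=.
have aE : contraction_rate = damping * M ^+ 2.
  by have := cE; rewrite /contraction_rate; lra.
have n_le : '|S (S u)| ^+ 2 <= M ^+ 2 * '|S u| ^+ 2.
  by rewrite -exprMn ler_pXn2r ?nnegrE ?mulr_ge0 ?l2norm_ge0// Sle.
have cn : (damping * '|S (S u)|) ^+ 2 <= damping * contraction_rate * '|S u| ^+ 2.
  rewrite aE exprMn (_ : _ * _ = damping ^+ 2 * (M ^+ 2 * '|S u| ^+ 2)); last by ring.
  by rewrite ler_wpM2l// sqr_ge0.
have : 0 <= contraction_rate * (damping * '|S u| ^+ 2).
  by rewrite mulr_ge0// mulr_ge0 ?sqr_ge0// ltW.
move: cn; rewrite !exprMn; lra.
Qed.

Lemma D0_damped_step u : D0 u -> D0 (damped_step u).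
Proof.
move=> Du; apply: D0_add => //; apply: D0_opp; apply: D0_scale.
by apply: D0_lin => //; apply: SD0; exact: SD0.
Qed.

Lemma D0_residual xi n : D0 xi -> D0 (residual xi n).
Proof. by move=> Dx; elim: n => //= n IH; exact: D0_damped_step. Qed.

Lemma D0_neumann_sum xi n : D0 xi -> D0 (neumann_sum xi n).
Proof. by move=> Dx; apply: D0_scale; apply: D0_sum => j; exact: D0_residual. Qed.

Lemma D0_poly_resolvent xi n : D0 xi -> D0 (poly_resolvent xi n).
Proof.
move=> Dx; apply: D0_add; first by apply: D0_scale; exact: D0_neumann_sum.
by apply: D0_opp; apply: SD0; exact: D0_neumann_sum.
Qed.

Lemma residual_le xi n : D0 xi -> '|residual xi n| <= contraction_rate ^+ n * '|xi|.
Proof.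
move=> Dx; have /andP[a0 a1] := contraction_rate_bound.
elim: n => [|n IH]; first by rewrite expr0 mul1r.
rewrite exprS -mulrA (le_trans (damped_step_le (D0_residual n Dx)))//.
by rewrite ler_wpM2l.
Qed.

Lemma neumann_sumP xi n :
  (t ^+ 2)%:C%C *: neumann_sum xi n + S (S (neumann_sum xi n)) = xi - residual xi n.
Proof.
elim: n => [|n IH].
  by rewrite /neumann_sum big_ord0 scaler0 S0 S0 scaler0 addr0 subrr.
have -> : neumann_sum xi n.+1 = neumann_sum xi n + damping%:C%C *: residual xi n.
  by rewrite /neumann_sum big_ord_recr scalerDr.
rewrite scalerDr !SD addrACA IH !SZ scalerA mulrC -scalerA -scalerDr.
by rewrite [residual xi n.+1]/(damped_step _) /damped_step opprB -addrA; congr (_ + _); rewrite addrC.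
Qed.

Lemma poly_resolventP xi n :
  (t%:C%C * 'i%C) *: poly_resolvent xi n - S (poly_resolvent xi n) =
  xi - residual xi n.
Proof.
rewrite -neumann_sumP /poly_resolvent; move: (neumann_sum xi n) => u.
rewrite scaleNr -opprD scalerN SN opprK SD SZ scalerDr scalerA opprD -addrA addKr.
rewrite -scaleNr; congr (_ *: _ + _).
by rewrite mulrACA -expr2 -expr2 sqr_i mulrN1 opprK rmorphXn.
Qed.

(** With u the Neumann sum, |poly_resolvent|^2 = t ^ 2 |u|^2 + |S u|^2 =
    <(t ^ 2 + S ^ 2) u, u>, and (t ^ 2 + S ^ 2) u = xi - residual has norm at most
    2 |xi|. The bound is free of M and n, which the truncation argument needs. *)
Lemma poly_resolvent_le xi n : D0 xi ->
  '|poly_resolvent xi n| <= 2 / `|t| * '|xi|.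
Proof.
move=> Dx; have /andP[a0 a1] := contraction_rate_bound.
have Du : D0 (neumann_sum xi n) by exact: D0_neumann_sum.
have := neumann_sumP xi n; set u := neumann_sum xi n in Du * => uE.
have nu : '|(t ^+ 2)%:C%C *: u + S (S u)| <= 2 * '|xi|.
  rewrite uE (le_trans (norml2B _ _))// mulrDl mul1r lerD2l.
  rewrite (le_trans (residual_le n Dx))// ler_piMl ?l2norm_ge0//.
  by rewrite exprn_ile1// ltW.
have E : Re (l2dot ((t ^+ 2)%:C%C *: u + S (S u)) u) = t ^+ 2 * '|u| ^+ 2 + '|S u| ^+ 2.
  rewrite dotDl dotZl Ssym//; last exact: SD0.
  by rewrite !dotff Re_add Re_realM.
have := Re_dot_le ((t ^+ 2)%:C%C *: u + S (S u)) u; rewrite E => h.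
have n2 : '|poly_resolvent xi n| ^+ 2 = t ^+ 2 * '|u| ^+ 2 + '|S u| ^+ 2.
  have DSu : D0 (S u) by exact: SD0.
  rewrite /poly_resolvent -/u sqr_norml2B dotZl norml2Z exprMn normc_opp normcM normc_real.
  have -> : normc 'i%C = 1 :> R by rewrite /= expr0n expr1n add0r sqrtr1.
  rewrite mulr1 real_normK ?num_real//.
  have -> : Re (- (t%:C%C * 'i%C) * l2dot u (S u)) = 0.
    have : complex.Im (l2dot u (S u)) = 0.
      have /(congr1 (@complex.Im R)) : l2dot u (S u) = (l2dot u (S u))^*%C.
        by rewrite -dotC Ssym.
      by case: (l2dot _ _) => a b /= hb; lra.
    by case: (l2dot _ _) => a b /= ->; ring.
  by rewrite mulr0 subr0.
have tp : 0 < `|t| by rewrite normr_gt0.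
have tt : `|t| ^+ 2 = t ^+ 2 by rewrite real_normK ?num_real.
have h2 : t ^+ 2 * '|u| ^+ 2 + '|S u| ^+ 2 <= 2 * '|xi| * '|u|.
  by rewrite (le_trans h)// ler_wpM2r// l2norm_ge0.
have u_le : t ^+ 2 * '|u| <= 2 * '|xi|.
  have [u0|u0] := eqVneq '|u| 0; first by rewrite u0 mulr0 mulr_ge0// l2norm_ge0.
  have up : 0 < '|u| by rewrite lt_neqAle eq_sym u0 l2norm_ge0.
  rewrite -(ler_pM2r up) -mulrA -expr2; apply: le_trans h2.
  by rewrite lerDl sqr_ge0.
rewrite -(@ler_pXn2r _ 2)// ?nnegrE ?mulr_ge0 ?l2norm_ge0// ?divr_ge0//.
rewrite n2 (le_trans h2)// exprMn expr_div_n tt [leRHS]mulrAC ler_pdivlMr//.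
have := l2norm_ge0 xi; nra.
Qed.

Lemma damped_step_linear : linear damped_step.
Proof.
move=> c f g; rewrite /damped_step !Slin; move: (S (S f)) (S (S g)) => f2 g2.
by apply: l2E; apply/funext => x; rewrite !l2_coordE; ring.
Qed.

Lemma poly_resolvent_linear n : linear (poly_resolvent^~ n).
Proof.
have rl j : linear (residual^~ j).
  by elim: j => // j IH c f g; rewrite /residual !iterS -!/(residual _ _) IH damped_step_linear.
have ul : linear (neumann_sum^~ n).
  move=> c f g; rewrite /neumann_sum scalerA mulrC -scalerA -scalerDr; congr (_ *: _).
  by rewrite scaler_sumr -big_split; apply: eq_bigr => j _; exact: rl.
move=> c f g; rewrite /poly_resolvent ul Slin.
by rewrite scalerDr scalerBr !scalerA (mulrC c) opprD addrACA.
Qed.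

End Polynomial.

(** Common induction behind three facts on random polynomials in an operator:
    their supports are bounded uniformly, they are measurable, and they commute
    with translations. *)
Lemma poly_resolvent_ind (R : realType) (G : choiceType) (L : Type)
    (S : L -> l2 R G -> l2 R G) (t M : R) (P : (L -> l2 R G) -> Prop)
    (PD : forall F F', P F -> P F' -> P (fun l => F l + F' l))
    (PZ : forall c F, P F -> P (fun l => c *: F l))
    (PS : forall F, P F -> P (fun l => S l (F l))) n F :
  P F -> P (fun l => poly_resolvent (S l) t M (F l) n).
Proof.
move=> PF.
have PN F' : P F' -> P (fun l => - F' l).
  by move=> /(PZ (-1)); under [X in P X -> _]eq_fun do rewrite scaleN1r.
have Pr j : P (fun l => residual (S l) t M (F l) j).
  elim: j => //= j IH; apply: (PD _ _ IH); apply: (PN); apply: (PZ).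
  by apply: (PD); [exact: PZ | apply: (PS); exact: PS].
have Pu : P (fun l => neumann_sum (S l) t M (F l) n).
  apply: (PZ); elim: n => [|n IH].
    have := PZ 0 _ PF; congr P; apply/funext => l.
    by rewrite scale0r big_ord0.
  have := PD _ _ IH (Pr n); congr P; apply/funext => l.
  by rewrite big_ord_recr.
by apply: (PD); [exact: PZ | apply: (PN); exact: PS].
Qed.

(** * Finite range truncations of a kernel on a group *)

Section Band.
Variables (R : realType) (G : groupType).
Local Notation H := (l2 R G).
Local Notation kern := (G -> G -> R[i]).
Local Notation "''|' f |" := (l2norm (l2fun f)) (at level 0, f at level 99, format "''|' f |").
Variables (K : {fset G}) (m : R).
Implicit Types (k : kern) (f : H).

Definition trunc (c : R[i]) : R[i] := if normc c <= m then c else 0.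

(** Entries are kept at positions (x, h x) with h in K: right translations
    of both arguments preserve y x^-1, so truncation commutes with them. *)
Definition band k : kern := fun x y =>
  if (y * x^-1)%g \in K then trunc (k x y) else 0.

Hypothesis m0 : 0 <= m.

Lemma normc_trunc c : normc (trunc c) <= m.
Proof. by rewrite /trunc; case: ifP => // _; rewrite normc0. Qed.

Lemma mulg_bij (h : G) : bijective (fun x : G => h * x)%g.
Proof. by exists (fun x => h^-1 * x)%g => x; rewrite ?mulKg ?mulVKg. Qed.

Lemma mulgr_bij (h : G) : bijective (fun x : G => x * h)%g.
Proof. by exists (fun x => x * h^-1)%g => x; rewrite ?mulgK ?mulgVK. Qed.

Lemma band_term_sqnorm k (h : G) (f : G -> R[i]) :
  (sqnorm (fun x => (trunc (k x (h * x)%g) * f (h * x)%g)%R) <= (m ^+ 2)%:E * sqnorm f)%E.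
Proof.
apply: (@le_trans _ _ (\esum_(x in [set: G]) ((m ^+ 2)%:E * (normc (f (h * x)%g) ^+ 2)%:E))%E).
  apply: le_esum => x _; rewrite -EFinM lee_fin normcM exprMn ler_wpM2r ?sqr_ge0//.
  by rewrite ler_pXn2r ?nnegrE ?normc_ge0// normc_trunc.
apply: (le_trans (esumZ_le _ _)); [exact: sqr_ge0 | by move=> x; rewrite lee_fin sqr_ge0 |].
rewrite le_eqVlt; apply/orP; left; apply/eqP; congr (_ * _)%E.
rewrite /sqnorm [RHS](@reindex_esum _ _ _ [set: G] _ (fun x => h * x)%g)//.
by rewrite setTT_bijective; exact: mulg_bij.
Qed.

Lemma band_term_square_summable k (h : G) f :
  square_summable (fun x => trunc (k x (h * x)%g) * f (h * x)%g).
Proof.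
apply: le_lt_trans (band_term_sqnorm _ _ _) _.
by rewrite (sqr_l2norm (l2_square_summable f)) -EFinM ltry.
Qed.

(** The sum over K makes sense on all of l2(G), and is the action of the banded
    kernel there by [bandop_kernel]. *)
Definition bandop k f : H := \sum_(h <- K) l2_of (band_term_square_summable k h f).

Lemma bandopE k f x :
  bandop k f x = \sum_(h <- K) trunc (k x (h * x)%g) * f (h * x)%g.
Proof. by rewrite l2sumE. Qed.

Lemma bandop_kernel k f : l2fun (bandop k f) = kernel_action (band k) f.
Proof.
apply/funext => x; rewrite bandopE /kernel_action.
rewrite (reindex_fsbigT (fun h : G => h * x)%g _ (mulgr_bij x)).
rewrite (@fsbigTE _ _ _ _ K) => [|h hK].
  apply: eq_big_seq => h hK; by rewrite /band mulgK hK.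
by rewrite /band mulgK (negbTE hK) mul0r.
Qed.

Lemma bandop_linear k : linear (bandop k).
Proof.
move=> c f g; apply: l2E; apply/funext => x.
rewrite -[RHS]/(c * bandop k f x + bandop k g x) !bandopE mulr_sumr -big_split.
by apply: eq_bigr => h _; rewrite !l2_coordE /=; ring.
Qed.

Definition band_bound : R := m *+ #|` K|.

(** Each of the #|K| diagonals is a translation followed by a multiplication by
    a function bounded by m. *)
Lemma bandop_le k f : '|bandop k f| <= band_bound * '|f|.
Proof.
rewrite /bandop /band_bound.
elim: (K : seq G) => [|h s IH]; first by rewrite big_nil norml20 mulr0n mul0r.
rewrite big_cons (le_trans (norml2D _ _))//= mulrS mulrDl lerD//.
rewrite -(@ler_pXn2r _ 2)// ?nnegrE ?mulr_ge0 ?l2norm_ge0//.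
rewrite -lee_fin exprMn (EFinM (m ^+ 2)) -(sqr_l2norm (l2_square_summable f)).
rewrite -(sqr_l2norm (l2_square_summable (l2_of (band_term_square_summable k h f)))).
exact: band_term_sqnorm.
Qed.

Lemma bandop_support (A : {fset G}) : exists B : {fset G}, forall k f,
  (forall x, x \notin A -> f x = 0) -> forall x, x \notin B -> bandop k f x = 0.
Proof.
exists [fset (h^-1 * a)%g | h in K, a in A]%fset => k f fA x xB.
rewrite bandopE big_seq big1// => h hK; rewrite fA ?mulr0//.
apply: contra xB => hx; apply/imfset2P; exists h => //; exists (h * x)%g => //.
by rewrite mulKg.
Qed.

Lemma D0_bandop k f : D0 f -> D0 (bandop k f).
Proof.
by move=> /D0P[A fA]; have [B hB] := bandop_support A; apply/D0P; exists B; exact: hB.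
Qed.

Hypothesis Ksym : forall h, h \in K -> (h^-1)%g \in K.

Lemma bandop_symmetric k f g : (forall x y, k x y = (k y x)^*%C) ->
  D0 f -> D0 g -> l2dot (bandop k f) g = l2dot f (bandop k g).
Proof.
move=> kherm Df Dg.
have bherm x y : band k x y = (band k y x)^*%C.
  rewrite /band /trunc (kherm x y) normc_conj.
  have -> : (y * x^-1)%g \in K = ((x * y^-1)%g \in K).
    by apply/idP/idP => /Ksym; rewrite invgM invgK.
  by case: ifP => _; [case: ifP => _|]; rewrite ?conjc0.
have Tg : kernel_operator (band k) (g, bandop k g) by split; rewrite /= ?bandop_kernel.
by apply: (symmetric_kernel_operator bherm Tg); split; rewrite /= ?bandop_kernel.
Qed.

Variables (s t : R).
Hypothesis t0 : t != 0.

Definition shifted_band k f : H := bandop k f - s%:C%C *: f.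

Definition shifted_bound : R := band_bound + `|s|.

(** For z = s + i t one has z - T = i t - (T - s), whence the shift of T by s. *)
Definition band_resolvent k (xi : H) n : H :=
  poly_resolvent (shifted_band k) t shifted_bound xi n.

Lemma shifted_band_linear k : linear (shifted_band k).
Proof.
move=> c f g; rewrite /shifted_band bandop_linear scalerDr scalerBr !scalerA (mulrC c).
by rewrite opprD addrACA.
Qed.

Lemma shifted_band_le k f : '|shifted_band k f| <= shifted_bound * '|f|.
Proof.
rewrite (le_trans (norml2B _ _))// norml2Z normc_real mulrDl lerD2r.
exact: bandop_le.
Qed.

Lemma D0_shifted_band k f : D0 f -> D0 (shifted_band k f).
Proof.
by move=> Df; apply: D0_add; [exact: D0_bandop|apply: D0_opp; exact: D0_scale].
Qed.

Lemma shifted_bound_ge0 : 0 <= shifted_bound.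
Proof. by rewrite addr_ge0// mulrn_wge0. Qed.

Lemma band_resolvent_linear k n : linear (band_resolvent k ^~ n).
Proof. apply: poly_resolvent_linear; exact: shifted_band_linear. Qed.

Lemma D0_band_resolvent k xi n : D0 xi -> D0 (band_resolvent k xi n).
Proof. by apply: D0_poly_resolvent; exact: D0_shifted_band. Qed.

Section Hermitian.
Variable k : kern.
Hypothesis kherm : forall x y, k x y = (k y x)^*%C.

Lemma shifted_band_symmetric f g : D0 f -> D0 g ->
  l2dot (shifted_band k f) g = l2dot f (shifted_band k g).
Proof.
move=> Df Dg; rewrite dotDl dotDr dotNl dotNr dotZl dotZr conjc_real.
by rewrite bandop_symmetric.
Qed.

Lemma band_resolvent_le xi n : D0 xi ->
  '|band_resolvent k xi n| <= 2 / `|t| * '|xi|.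
Proof.
apply: poly_resolvent_le => //.
- exact: shifted_band_linear.
- exact: D0_shifted_band.
- exact: shifted_band_symmetric.
- exact: shifted_bound_ge0.
- by move=> f _; exact: shifted_band_le.
Qed.

Lemma band_resolvent_error xi n : D0 xi ->
  '|(s +i* t)%C *: band_resolvent k xi n - bandop k (band_resolvent k xi n) - xi| <=
  contraction_rate t shifted_bound ^+ n * '|xi|.
Proof.
move=> Dx; have := poly_resolventP t shifted_bound (shifted_band_linear k) xi n.
rewrite -/(band_resolvent k xi n) /shifted_band => E.
have -> : (s +i* t)%C *: band_resolvent k xi n - bandop k (band_resolvent k xi n) - xi
   = - residual (shifted_band k) t shifted_bound xi n.
  have -> : (s +i* t)%C = t%:C%C * 'i%C + s%:C%C :> R[i].
    by apply/eqP; rewrite eq_complex /=; apply/andP; split; apply/eqP; ring.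
  move: (band_resolvent k xi n) (bandop k _) E => u v /eqP; rewrite -subr_eq0 => /eqP E.
  apply/eqP; rewrite -subr_eq0 opprK; apply/eqP; rewrite -[RHS]E.
  by apply: l2E; apply/funext => x; rewrite !l2_coordE; ring.
rewrite norml2N; apply: residual_le => //.
- exact: D0_shifted_band.
- exact: shifted_band_symmetric.
- exact: shifted_bound_ge0.
- by move=> f _; exact: shifted_band_le.
Qed.

End Hermitian.

Lemma contraction_rate_lt1 : 0 <= contraction_rate t shifted_bound < 1.
Proof. exact: contraction_rate_bound. Qed.

(** The support is bounded uniformly in the kernel: a random approximate
    resolvent lives on a deterministic finite set. *)
Lemma band_resolvent_support x n : exists A : {fset G}, forall k y,
  y \notin A -> band_resolvent k (delta x) n y = 0.
Proof.
pose P (F : kern -> H) := exists A : {fset G}, forall k y, y \notin A -> F k y = 0.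
have PD F F' : P F -> P F' -> P (fun l => F l + F' l).
  move=> [A hA] [B hB]; exists (A `|` B)%fset => k y; rewrite inE negb_or => /andP[yA yB].
  by rewrite l2DE hA// hB// addr0.
have PZ c F : P F -> P (fun l => c *: F l).
  by move=> [A hA]; exists A => k y yA; rewrite l2ZE hA// mulr0.
apply: (@poly_resolvent_ind _ _ _ _ _ _ P PD PZ).
  move=> F PF; rewrite /shifted_band; apply: (PD); last first.
    have := PZ (- s%:C%C) _ PF; congr P; apply/funext => l; exact: scaleNr.
  have [A hA] := PF; have [B hB] := bandop_support A; exists B => k y; apply: hB; exact: hA.
by exists [fset x]%fset => k y; rewrite inE deltaE => /negbTE ->.
Qed.

Definition translate (z : G) k : kern := fun x y => k (x * z)%g (y * z)%g.

Lemma band_translate z k x y : band k (x * z)%g (y * z)%g = band (translate z k) x y.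
Proof. by rewrite /band /translate invgM mulgA mulgK. Qed.

(** Equivariance: the approximate resolvent of the translated kernel is the
    translate of the approximate resolvent. *)
Lemma band_resolvent_translate z k x y n :
  band_resolvent k (delta (x * z)%g) n (y * z)%g =
  band_resolvent (translate z k) (delta x) n y.
Proof.
(* The two kernels are treated as one family indexed by a boolean. *)
pose kk (b : bool) := if b then k else translate z k.
pose P (F : bool -> H) := forall y, F true (y * z)%g = F false y.
have PD F F' : P F -> P F' -> P (fun l => F l + F' l).
  by move=> h h' u; rewrite !l2DE h h'.
have PZ c F : P F -> P (fun l => c *: F l) by move=> h u; rewrite !l2ZE h.
have := @poly_resolvent_ind _ _ _ (fun b => shifted_band (kk b)) t shifted_bound P PD PZ _ n
  (fun b => delta (if b then x * z else x)%g).
apply.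
  move=> F PF; rewrite /shifted_band; apply: (PD); last first.
    have := PZ (- s%:C%C) _ PF; congr P; apply/funext => l; exact: scaleNr.
  by move=> u; rewrite !bandopE; apply: eq_bigr => h _; rewrite /kk /translate mulgA PF.
move=> u; rewrite !deltaE; congr (nat_of_bool _)%:R.
by apply/eqP/eqP => [/mulIg|->].
Qed.

End Band.

(** * Sums over a countable index set *)

Section CountableSum.
Variables (R : realType) (G : choiceType).
Hypothesis Gc : countable [set: G].
Local Open Scope ereal_scope.

(** A partial enumeration, because G may be finite. *)
Lemma countable_enum : exists e : nat -> option G, exists j : G -> nat,
  (forall x, e (j x) = Some x) /\ (forall n, (forall x, j x <> n) -> e n = None).
Proof.
have /countable_injP[j injj] := Gc.
exists (fun n => if pselect (exists x, j x = n) is left h then Some (projT1 (cid h)) else None), j.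
split=> [x|n nx]; case: pselect => // h.
- by case: cid => y /= jy; congr Some; apply: injj; rewrite ?inE.
- by case: h; exists x.
- by case: h => x jx; case: (nx x jx).
Qed.

Lemma esum_nneseries (e : nat -> option G) (j : G -> nat) (f : G -> \bar R) :
  (forall x, e (j x) = Some x) -> (forall n, (forall x, j x <> n) -> e n = None) ->
  (forall x, 0 <= f x) ->
  \esum_(x in [set: G]) f x = \sum_(n <oo) oapp f 0 (e n).
Proof.
move=> ej eN f0.
have b0 n : 0 <= oapp f 0 (e n) by case: (e n) => //=.
rewrite nneseries_esumT//.
transitivity (\esum_(n in range j) oapp f 0 (e n)).
  rewrite (@reindex_esum _ _ _ [set: G] (range j) j); last first.
    split; [by move=> x _; exists x | | by move=> _ [x _ <-]; exists x].
    by move=> x y _ _ jxy; have := ej x; rewrite jxy ej => -[].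
  by apply: eq_esum => x _; rewrite ej.
rewrite esum_mkcond; apply: eq_esum => n _; case: ifPn => //.
rewrite notin_setE => nj; rewrite eN// => x xn; apply: nj.
by exists x.
Qed.

Lemma measurable_esum d (T : measurableType d) (f : G -> T -> \bar R) :
  (forall x, measurable_fun [set: T] (f x)) -> (forall x w, 0 <= f x w) ->
  measurable_fun [set: T] (fun w => \esum_(x in [set: G]) f x w).
Proof.
move=> mf f0; have [e [j [ej eN]]] := countable_enum.
have -> : (fun w => \esum_(x in [set: G]) f x w) =
    (fun w => \sum_(n <oo) oapp (f ^~ w) 0 (e n)).
  by apply/funext => w; exact: esum_nneseries.
apply: ge0_emeasurable_sum => [k x _ _|k _]; first by case: (e k) => /=.
by case: (e k) => /= [x|]; [exact: mf | exact: measurable_cst].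
Qed.

Lemma integral_esum d (T : measurableType d) (mu : {measure set T -> \bar R})
    (f : G -> T -> \bar R) :
  (forall x, measurable_fun [set: T] (f x)) -> (forall x w, 0 <= f x w) ->
  \int[mu]_w (\esum_(x in [set: G]) f x w) = \esum_(x in [set: G]) \int[mu]_w f x w.
Proof.
move=> mf f0; have [e [j [ej eN]]] := countable_enum.
rewrite (esum_nneseries ej eN) => [|x]; last by apply: integral_ge0 => w _.
under eq_integral do rewrite (esum_nneseries ej eN) //.
rewrite integral_nneseries//.
- apply: eq_eseriesr => n _; case: (e n) => //=; exact: integral0.
- by move=> n; case: (e n) => /= [x|]; [exact: mf | exact: measurable_cst].
- by move=> n w _; case: (e n) => /=.
Qed.

End CountableSum.

(** * Measurability of complex and Hilbert space valued maps *)

Section ComplexMeasurable.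
Variable R : realType.
Local Notation C := R[i].
Local Notation Re := (@complex.Re R).
Local Notation Im := (@complex.Im R).

(** Measurability of complex functions through their real and imaginary parts,
    to which the results on real functions apply. *)
Definition complex_measurable d (T : measurableType d) (f : T -> C) : Prop :=
  measurable_fun [set: T] (fun w => Re (f w)) /\
  measurable_fun [set: T] (fun w => Im (f w)).

Lemma continuous_open_comp (p : C -> R) : (forall z w, `|p z - p w| <= normc (z - w)) ->
  forall U : set R, open U -> open (p @^-1` U).
Proof.
move=> pl U oU; rewrite openE => z /= Uz.
have /nbhs_ballP[e e0 eU] := open_nbhs_nbhs (conj oU Uz).
apply/nbhs_ballP; exists e%:C%C; first by rewrite /= ltcR.
move=> w; rewrite -ball_normE /ball_/= [ `|_| ]/(normc _)%:C%C ltcR => zw; apply: eU.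
by rewrite -ball_normE /ball_/= (le_lt_trans (pl _ _)).
Qed.

Lemma Re_lip (z w : C) : `|Re z - Re w| <= normc (z - w).
Proof. by have := normc_Re (z - w); rewrite Re_add Re_opp. Qed.

Lemma Im_lip (z w : C) : `|Im z - Im w| <= normc (z - w).
Proof. by have := normc_Im (z - w); rewrite Im_add Im_opp. Qed.

Section Fixed.
Context d (T : measurableType d).
Implicit Types f g : T -> C.

Lemma complex_measurable_open f : (forall U : set C, open U -> measurable (f @^-1` U)) -> complex_measurable f.
Proof.
move=> hf; have P (p : C -> R) : (forall z w, `|p z - p w| <= normc (z - w)) ->
    measurable_fun [set: T] (fun w => p (f w)).
  move=> pl; apply: measurability; first exact: RGenOInfty.measurableE.
  move=> _ [_ [x ->] <-]; rewrite setTI.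
  apply: (hf (p @^-1` `]x, +oo[)); apply: continuous_open_comp => //; exact: interval_open.
by split; apply: P; [exact: Re_lip | exact: Im_lip].
Qed.

Lemma complex_measurable_borel f : borel_measurable f -> complex_measurable f.
Proof.
move=> mf; apply: complex_measurable_open => U oU; rewrite -[X in measurable X]setTI.
by apply: mf => //; exact: sub_sigma_algebra.
Qed.

Lemma complex_measurable_cst (c : C) : complex_measurable (fun _ : T => c).
Proof. by split; exact: measurable_cst. Qed.

Lemma complex_measurableD f g : complex_measurable f -> complex_measurable g -> complex_measurable (fun w => f w + g w).
Proof.
move=> [f1 f2] [g1 g2]; split.
  by under eq_fun do rewrite Re_add; exact: measurable_funD.
by under eq_fun do rewrite Im_add; exact: measurable_funD.
Qed.

Lemma complex_measurableM f g : complex_measurable f -> complex_measurable g -> complex_measurable (fun w => f w * g w).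
Proof.
move=> [f1 f2] [g1 g2]; split.
  by under eq_fun do rewrite Re_mul; apply: measurable_funB; exact: measurable_funM.
by under eq_fun do rewrite Im_mul; apply: measurable_funD; exact: measurable_funM.
Qed.

Lemma complex_measurableB f g : complex_measurable f -> complex_measurable g -> complex_measurable (fun w => f w - g w).
Proof.
move=> hf hg; under eq_fun do rewrite -mulN1r.
by apply: complex_measurableD => //; apply: complex_measurableM => //; exact: complex_measurable_cst.
Qed.

Lemma complex_measurable_sum (I : Type) (s : seq I) (F : I -> T -> C) :
  (forall i, complex_measurable (F i)) -> complex_measurable (fun w => \sum_(i <- s) F i w).
Proof.
move=> hF; elim: s => [|i s IH].
  by under eq_fun do rewrite big_nil; exact: complex_measurable_cst.
by under eq_fun do rewrite big_cons; exact: complex_measurableD.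
Qed.

Lemma complex_measurable_normc2 f : complex_measurable f -> measurable_fun [set: T] (fun w => normc (f w) ^+ 2).
Proof.
move=> [f1 f2]; under eq_fun do rewrite normc_sq.
by apply: measurable_funD; exact: measurable_funX.
Qed.

Lemma complex_measurable_enormc2 f : complex_measurable f ->
  measurable_fun [set: T] (fun w => (normc (f w) ^+ 2)%:E).
Proof. by move=> hf; apply/measurable_EFinP; exact: complex_measurable_normc2. Qed.

Lemma complex_measurable_if (b : T -> bool) f g : measurable_fun [set: T] b ->
  complex_measurable f -> complex_measurable g -> complex_measurable (fun w => if b w then f w else g w).
Proof.
move=> mb [f1 f2] [g1 g2]; split.
  have -> : (fun w => Re (if b w then f w else g w)) =
    (fun w => if b w then Re (f w) else Re (g w)) by apply/funext => w; case: ifP.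
  exact: measurable_fun_ifT.
have -> : (fun w => Im (if b w then f w else g w)) =
  (fun w => if b w then Im (f w) else Im (g w)) by apply/funext => w; case: ifP.
exact: measurable_fun_ifT.
Qed.

Lemma complex_measurable_trunc (m : R) f : 0 <= m -> complex_measurable f -> complex_measurable (fun w => trunc m (f w)).
Proof.
move=> m0 hf; apply: (@complex_measurable_if (fun w => normc (f w) <= m) f (fun=> 0)) => //.
have -> : (fun w => normc (f w) <= m) = (fun w => normc (f w) ^+ 2 <= m ^+ 2).
  by apply/funext => w; rewrite ler_pXn2r// nnegrE ?normc_ge0.
apply: measurable_fun_ler; last exact: measurable_cst.
exact: complex_measurable_normc2.
Qed.

Lemma complex_measurable_lim (F : nat -> T -> C) f : (forall n, complex_measurable (F n)) ->
  (forall w (e : R), 0 < e -> exists N, forall n, (N <= n)%N -> normc (F n w - f w) <= e) ->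
  complex_measurable f.
Proof.
move=> hF hlim.
have P (p : C -> R) : (forall z w, `|p z - p w| <= normc (z - w)) ->
    (forall n, measurable_fun [set: T] (fun w => p (F n w))) ->
    measurable_fun [set: T] (fun w => p (f w)).
  move=> pl mp; apply: (measurable_fun_cvg mp) => w _.
  apply/cvgrPdist_le => e e0; have [N hN] := hlim w e e0; exists N => // n /= Nn.
  by rewrite distrC (le_trans (pl _ _))// hN.
split.
  by apply: P => [|n]; [exact: Re_lip|case: (hF n)].
by apply: P => [|n]; [exact: Im_lip|case: (hF n)].
Qed.

End Fixed.

Lemma complex_measurable_comp d d' (T : measurableType d) (T' : measurableType d')
    (phi : T -> T') (f : T' -> C) :
  measurable_fun [set: T] phi -> complex_measurable f -> complex_measurable (fun w => f (phi w)).
Proof. by move=> mp [f1 f2]; split; [exact: (measurableT_comp f1) | exact: (measurableT_comp f2)]. Qed.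

End ComplexMeasurable.

Section L2Measurable.
Variables (R : realType) (G : choiceType).
Hypothesis Gc : countable [set: G].
Local Notation C := R[i].
Local Notation H := (l2 R G).
Local Notation "''|' f |" := (l2norm (l2fun f)) (at level 0, f at level 99, format "''|' f |").

Lemma measurable_sqnorm d (T : measurableType d) (X : T -> G -> C) :
  (forall y, complex_measurable (fun w => X w y)) -> measurable_fun [set: T] (fun w => sqnorm (X w)).
Proof.
move=> hX; apply: measurable_esum => // [x|x w]; last by rewrite lee_fin sqr_ge0.
exact: complex_measurable_enormc2.
Qed.

Lemma rat_complex_dense (z : C) (e : R) : 0 < e ->
  exists p : rat * rat, normc (z - (ratr p.1 +i* ratr p.2)%C) < e.
Proof.
move=> e0; have h (x : R) : exists q : rat, `|x - ratr q| < e / 2.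
  have [|q] := @rat_in_itvoo R (x - e / 2) (x + e / 2); first lra.
  by rewrite in_itv /= => hq; exists q; rewrite ltr_distl; lra.
have [p hp] := h (complex.Re z); have [q hq] := h (complex.Im z).
exists (p, q); rewrite (le_lt_trans (normc_le_ReIm _))// Re_add Re_opp Im_add Im_opp /=.
by move: hp hq; lra.
Qed.

(** Finite combinations of point masses with Gaussian rational coefficients; the
    natural number in a code enumerates G. *)
Lemma l2_separable : exists c : seq (nat * (rat * rat)) -> H,
  forall (f : H) (e : R), 0 < e -> exists s, '|f - c s| < e.
Proof.
have [en [j [enj _]]] := countable_enum Gc.
pose term (p : nat * (rat * rat)) : H :=
  oapp (fun x => (ratr p.2.1 +i* ratr p.2.2)%C *: delta x) 0 (en p.1).
exists (fun s => \sum_(p <- s) term p) => f e e0.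
have [|A hA] := l2restrict_approx f (e := e / 2); first lra.
suff [s hs] : exists s, '|l2restrict A f - \sum_(p <- s) term p| < e / 2.
  exists s; rewrite -(subrK (l2restrict A f) f) -addrA.
  by rewrite (le_lt_trans (norml2D _ _))//; lra.
rewrite l2restrictE; have : 0 < e / 2 by lra.
elim: (A : seq G) (e / 2) => [|x A' IH] r r0.
  by exists [::]; rewrite !big_nil subr0 norml20.
have [|s hs] := IH (r / 2); first lra.
have [|q hq] := rat_complex_dense (f x) (e := r / 2); first lra.
exists ((j x, q) :: s); rewrite !big_cons.
have -> : term (j x, q) = (ratr q.1 +i* ratr q.2)%C *: delta x by rewrite /term enj.
rewrite opprD addrACA -scalerBl (le_lt_trans (norml2D _ _))// norml2Z l2norm_delta mulr1.
lra.
Qed.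

(** By separability an open set is a countable union of balls, and the squared
    distance to the centre of a ball is a countable sum of measurable functions. *)
Lemma l2_borel_measurable d (T : measurableType d) (X : T -> H) :
  (forall y, complex_measurable (fun w => X w y)) -> borel_measurable X.
Proof.
move=> hX; have [c hc] := l2_separable.
apply: (@measurability _ _ T (g_sigma_algebraType (@open H)) setT X (@open H)) => // _ [U oU <-]; rewrite setTI.
pose J := (seq (nat * (rat * rat)) * rat)%type.
pose B (i : J) : set H := [set g | '|c i.1 - g| < ratr i.2].
have mB i : measurable (X @^-1` B i).
  have -> : X @^-1` B i = [set w | (sqnorm (X w - c i.1)%R < (ratr i.2 ^+ 2)%:E)%E] `&`
      [set w | 0 < ratr i.2 :> R].
    apply/seteqP; split => w; rewrite /B /= norml2_distC.
      move=> h; have h0 := le_lt_trans (l2norm_ge0 _) h; split => //.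
      by rewrite (sqr_l2norm (l2_square_summable (X w - c i.1))) lte_fin ltr_pXn2r// ?nnegrE ?l2norm_ge0// ltW.
    move=> [+ h]; rewrite (sqr_l2norm (l2_square_summable (X w - c i.1))) lte_fin ltr_pXn2r//.
      by rewrite nnegrE l2norm_ge0.
    by rewrite nnegrE ltW.
  apply: measurableI; last first.
    have [h|/negbTE h] := boolP (0 < (ratr i.2 : R)).
      by rewrite (_ : mkset _ = setT) //; apply/seteqP; split.
    by rewrite (_ : mkset _ = set0) //; apply/seteqP; split => // w /=; rewrite h.
  rewrite -[X in measurable X]setTI.
  have mlt : measurable_fun [set: T]
      (fun w => (sqnorm (X w - c i.1)%R < (ratr i.2 ^+ 2)%:E)%E).
    apply: measurable_fun_lte; last exact: measurable_cst.
    by apply: measurable_sqnorm => y; apply: (@complex_measurableB _ _ _ _ (fun=> c i.1 y) (hX y)).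
  exact: (mlt measurableT [set true]).
have -> : X @^-1` U = \bigcup_(i : J) (if `[< B i `<=` U >] then X @^-1` B i else set0).
  apply/seteqP; split=> w /=.
    move=> Uw; have /nbhs_ballP[e e0 eU] := open_nbhs_nbhs (conj oU Uw).
    have [r r0 er] := ltC_real e0.
    have [|q] := @rat_in_itvoo R 0 (r / 2); first lra.
    rewrite in_itv/= => /andP[q0 qr]; have [s hs] := hc (X w) _ q0.
    exists (s, q) => //; case: asboolP; first by rewrite /= /B /= norml2_distC.
    case=> g; rewrite /B /= => hg; apply: eU; rewrite er; apply/l2_ball.
    rewrite -(subrK (c s) (X w)) -addrA (le_lt_trans (norml2D _ _))//; lra.
  by move=> [i _]; case: asboolP => // BU /BU.
apply: countable_bigcupT_measurable; first exact: (@countableP J).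
by move=> i; case: ifP => _ //.
Qed.

End L2Measurable.

Lemma complex_measurable_band_resolvent (R : realType) (G : groupType) d (T : measurableType d)
    (kappa : T -> G -> G -> R[i]) (K : {fset G}) (m : R) (m0 : 0 <= m) (s t : R) n x y :
  (forall u v, complex_measurable (fun w => kappa w u v)) ->
  complex_measurable (fun w => band_resolvent K m0 s t (kappa w) (delta x) n y).
Proof.
move=> hk; pose P (F : T -> l2 R G) := forall y, complex_measurable (fun w => F w y).
have PD F F' : P F -> P F' -> P (fun l => F l + F' l).
  by move=> h h' u; exact: (complex_measurableD (h u) (h' u)).
have PZ c F : P F -> P (fun l => c *: F l).
  move=> h u; have hc : complex_measurable (fun _ : T => c) by exact: complex_measurable_cst.
  exact: (complex_measurableM hc (h u)).
apply: (@poly_resolvent_ind _ _ _ (fun w => shifted_band K m0 s (kappa w)) t _ P PD PZ) => [F PF|u].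
  apply: (PD); last first.
    have := PZ (- s%:C%C) _ PF; congr P; apply/funext => l; exact: scaleNr.
  move=> u; under eq_fun do rewrite bandopE.
  apply: complex_measurable_sum => h; apply: complex_measurableM => //; exact: complex_measurable_trunc.
exact: complex_measurable_cst.
Qed.

(** * The law of a stationary random kernel *)

(** Two finite measures that agree on a pi-system agree on the sigma-algebra it
    generates; here they are the laws of X and Y. *)
Section EqualLaw.
Variables (R : realType) (T : pointedType) (B : set (set T)).
Hypotheses (B_setI : setI_closed B) (B_setT : B setT).
Variables (d : measure_display) (Omega : measurableType d) (P : probability Omega R).
Variables X Y : Omega -> g_sigma_algebraType B.
Hypotheses (mX : measurable_fun [set: Omega] X) (mY : measurable_fun [set: Omega] Y).
Hypothesis XY : forall S, B S -> P (X @^-1` S) = P (Y @^-1` S).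

Let X_mixin := isMeasurableFun.Build _ _ _ _ _ mX.
Let X_mfun : {mfun Omega >-> g_sigma_algebraType B} := HB.pack X X_mixin.
Let Y_mixin := isMeasurableFun.Build _ _ _ _ _ mY.
Let Y_mfun : {mfun Omega >-> g_sigma_algebraType B} := HB.pack Y Y_mixin.

Lemma equal_law_integral (h : g_sigma_algebraType B -> \bar R) :
  measurable_fun setT h -> (forall k, (0 <= h k)%E) ->
  (\int[P]_w h (X w) = \int[P]_w h (Y w))%E.
Proof.
move=> mh h0.
have law S : measurable S -> distribution P X_mfun S = distribution P Y_mfun S.
  apply: (@measure_unique _ R (g_sigma_algebraType B) B (fun=> setT) _ _ _ _
    (distribution P X_mfun) (distribution P Y_mfun)) => //.
  - exact: bigcup_const.
  - by move=> k; apply: (le_lt_trans (probability_le1 _ _)); rewrite ?ltry.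
rewrite -[LHS](ge0_integral_distribution X_mfun)// -[RHS](ge0_integral_distribution Y_mfun)//.
by apply: eq_measure_integral => S mS _; exact: law.
Qed.

End EqualLaw.

Section KernelSpace.
Variables (R : realType) (G : groupType).
Local Notation C := R[i].
Local Notation kern := (G -> G -> C).

(** Finitely many open conditions on the entries: a pi-system for the product
    sigma-algebra on kernels, on which the invariance hypothesis applies
    directly. *)
Definition box : set (set kern) := [set S | exists F : {fset G},
  exists2 U : G -> G -> set C, (forall x y, open (U x y)) &
  S = [set k | forall x y, x \in F -> y \in F -> U x y (k x y)]].

Definition kernel_space := g_sigma_algebraType box.

Lemma box_setI : setI_closed box.
Proof.
move=> _ _ [F [U oU ->]] [F' [U' oU' ->]]; exists (F `|` F')%fset.
(* Each family of conditions is made void outside its own index set. *)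
pose on (E : {fset G}) (V : G -> G -> set C) x y := if (x \in E) && (y \in E) then V x y else setT.
exists (fun x y => on F U x y `&` on F' U' x y).
  by move=> x y; apply: openI; rewrite /on; case: ifP => // _; exact: openT.
apply/seteqP; split => k /=.
  by move=> [h h'] x y _ _; split; rewrite /on; case: ifP => // /andP[]; [exact: h|exact: h'].
move=> h; split => x y xF yF; have := h x y; rewrite !inE xF yF ?orbT => /(_ isT isT)[].
  by rewrite /on xF yF.
by move=> _; rewrite /on xF yF.
Qed.

Lemma box_setT : box setT.
Proof.
exists fset0; exists (fun _ _ => setT); first by move=> x y; exact: openT.
by apply/seteqP; split.
Qed.

Lemma complex_measurable_coord x y : complex_measurable (fun k : kernel_space => k x y).
Proof.
apply: complex_measurable_open => V oV; apply: sub_sigma_algebra.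
exists [fset x; y]%fset; exists (fun u v => if (u == x) && (v == y) then V else setT).
  by move=> u v; case: ifP => // _; exact: openT.
apply/seteqP; split => k /=.
  by move=> Vk u v _ _; case: ifP => // /andP[/eqP -> /eqP ->].
by move=> /(_ x y); rewrite !inE !eqxx orbT => /(_ isT isT).
Qed.

Variables (d : measure_display) (Omega : measurableType d) (P : probability Omega R).
Variable a : G -> G -> Omega -> C.
Hypothesis a_measurable : forall x y : G, borel_measurable (a x y).
Hypothesis a_invariant : forall (z : G) (F : {fset G})
        (E : set (prod_topology (fun _ : F * F => R[i]))),
      <<s @open (prod_topology (fun _ : F * F => R[i])) >> E ->
      P [set w | E (fun p => a (val p.1) (val p.2) w)] =
      P [set w | E (fun p => a (val p.1 * z)%g (val p.2 * z)%g w)].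

Definition random_kernel (w : Omega) : kernel_space := fun x y => a x y w.

Definition moved_kernel (z : G) (w : Omega) : kernel_space :=
  translate z (random_kernel w).

Lemma measurable_moved_kernel z : measurable_fun [set: Omega] (moved_kernel z).
Proof.
apply: (@measurability _ _ Omega kernel_space setT _ box) => // _ [_ [F [U oU ->]] <-].
rewrite setTI.
have -> : moved_kernel z @^-1` [set k | forall x y, x \in F -> y \in F -> U x y (k x y)] =
   \bigcap_(p in [set` F] `*` [set` F]) (a (p.1 * z)%g (p.2 * z)%g @^-1` U p.1 p.2).
  apply/seteqP; split => w /=.
    by move=> h [x y] [/= xF yF]; exact: h.
  by move=> h x y xF yF; exact: (h (x, y)).
apply: fin_bigcap_measurable; first by apply: finite_setX.
move=> [x y] _; rewrite -[X in measurable X]setTI.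
by apply: a_measurable => //; exact: sub_sigma_algebra.
Qed.

Lemma moved_kernel1 : moved_kernel 1%g = random_kernel.
Proof. by apply/funext => w; apply/funext => x; apply/funext => y; rewrite /moved_kernel /translate !mulg1. Qed.

Lemma measurable_random_kernel : measurable_fun [set: Omega] random_kernel.
Proof. by rewrite -moved_kernel1; exact: measurable_moved_kernel. Qed.

(** The hypothesis on finite families of entries extends to all measurable
    functionals of the whole kernel. *)
Lemma stationary_integral z (h : kernel_space -> \bar R) :
  measurable_fun [set: kernel_space] h -> (forall k, (0 <= h k)%E) ->
  (\int[P]_w h (random_kernel w) = \int[P]_w h (moved_kernel z w))%E.
Proof.
move=> mh h0; apply: (equal_law_integral box_setI box_setT measurable_random_kernel
  (measurable_moved_kernel z) _ mh h0).
move=> _ [F [U oU ->]].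
pose E : set (prod_topology (fun _ : F * F => C)) :=
  [set p | forall q : F * F, U (val q.1) (val q.2) (p q)].
have oE : open E.
  rewrite openE => p Ep.
  have pU (q : (F * F)%type) : nbhs p [set p' : prod_topology (fun _ : F * F => C) |
      U (val q.1) (val q.2) (p' q)].
    exact: (@proj_continuous _ (fun _ : F * F => C) q p _ (open_nbhs_nbhs (conj (oU _ _) (Ep q)))).
  exact: (filter_forall _ pU).
have mE : <<s @open (prod_topology (fun _ : F * F => C)) >> E by exact: sub_sigma_algebra.
have := a_invariant z mE.
have -> : [set w | E (fun p => a (val p.1) (val p.2) w)] = random_kernel @^-1`
    [set k | forall x y, x \in F -> y \in F -> U x y (k x y)].
  apply/seteqP; split => w /=.
    by move=> Ew x y xF yF; exact: (Ew ([` xF]%fset, [` yF]%fset)).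
  by move=> Ew [x y]; apply: Ew; exact: valP.
move=> ->; congr (P _); apply/seteqP; split => w /=.
  by move=> Ew x y xF yF; exact: (Ew ([` xF]%fset, [` yF]%fset)).
by move=> Ew [x y]; apply: Ew; exact: valP.
Qed.

End KernelSpace.

(** * Approximate resolvents in mean square *)

Section TransposeBound.
Variables (R : realType) (G : choiceType).
Local Notation H := (l2 R G).
Local Notation C := R[i].
Local Notation "''|' f |" := (l2norm (l2fun f)) (at level 0, f at level 99, format "''|' f |").

(** The left side is the squared norm of the transpose of Q applied to b. For c
    the conjugate of that vector truncated to a finite set, its squared norm over
    the set equals <Q c, conj b> <= M |c| |b|, and |c| is the norm being
    estimated; only the values of Q on finitely supported vectors occur. *)
Lemma transpose_bound (Q : H -> H) (M : R) (b : G -> C) :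
  linear Q -> (forall f, D0 f -> D0 (Q f)) -> 0 < M ->
  (forall f, D0 f -> '|Q f| <= M * '|f|) ->
  (\esum_(u in [set: G]) (normc (\sum_(y \in [set: G]) b y * Q (delta u) y)%R ^+ 2)%:E
     <= (M ^+ 2)%:E * sqnorm b)%E.
Proof.
move=> Qlin QD0 M0 Qle.
have [bss|bss] := pselect (square_summable b); last first.
  have -> : sqnorm b = +oo%E.
    by apply/eqP; rewrite -leye_eq leNgt; apply/negP.
  by rewrite gt0_muley ?leey// lte_fin exprn_gt0.
have cbss : square_summable (fun y => (b y)^*%C).
  rewrite /square_summable (_ : sqnorm _ = sqnorm b)//.
  by apply: eq_esum => y _; rewrite normc_conj.
pose bH : H := l2_of cbss.
have bHE : '|bH| ^+ 2 = fine (sqnorm b).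
  rewrite -[LHS]/(fine ('|bH| ^+ 2)%:E) -(sqr_l2norm (l2_square_summable bH)); congr fine.
  by apply: eq_esum => y _; rewrite /= normc_conj.
pose D u := l2dot (Q (delta u)) bH.
have DE u : \sum_(y \in [set: G]) b y * Q (delta u) y = D u.
  have [A hA] := D0_fset (QD0 _ (D0_delta R u)).
  rewrite /D (dot_fset _ hA) (@fsbigTE _ _ _ _ A) => [|y /hA ->]; last by rewrite mulr0.
  by apply: eq_bigr => y _; rewrite /= conjcK mulrC.
rewrite -(fineK (sqnorm_fin bss)) -EFinM -bHE.
apply: esum_le_ub => A; rewrite sumEFin lee_fin.
under eq_bigr do rewrite DE.
pose c := l2restrict A (fun u => (D u)^*%C).
have cE : '|c| ^+ 2 = \sum_(u <- A) normc (D u) ^+ 2.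
  apply: EFin_inj; rewrite -(sqr_l2norm (l2_square_summable c)) (@sqnorm_fset _ _ _ A).
    by congr EFin; apply: eq_big_seq => u uA; rewrite /= /restrict uA normc_conj.
  by move=> u; rewrite /= /restrict => /negbTE ->.
have dotE : l2dot (Q c) bH = (\sum_(u <- A) normc (D u) ^+ 2)%:C%C.
  rewrite /c l2restrictE (linear_combination _ _ _ Qlin) dot_suml rmorph_sum; apply: eq_bigr => u _.
  by rewrite dotZl mulrC mulc_conj.
have := Re_dot_le (Q c) bH; rewrite dotE /= -cE => h.
have h2 := Qle c (D0_l2restrict _ _).
have c0 := l2norm_ge0 c; have b0 := l2norm_ge0 bH.
have [->|cn0] := eqVneq '|c| 0; first by rewrite expr0n -exprMn sqr_ge0.
have cp : 0 < '|c| by rewrite lt_neqAle eq_sym cn0.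
rewrite -exprMn ler_pXn2r ?nnegrE// ?mulr_ge0// ?(ltW M0)//.
by rewrite -(ler_pM2l cp) -expr2 (le_trans h)// mulrA [_ * M]mulrC ler_wpM2r.
Qed.

End TransposeBound.

Section MeanSquare.
Variables (R : realType) (G : groupType).
Local Notation C := R[i].
Local Notation H := (l2 R G).
Local Notation "''|' f |" := (l2norm (l2fun f)) (at level 0, f at level 99, format "''|' f |").
Variables (d : measure_display) (Omega : measurableType d) (P : probability Omega R).
Variable a : G -> G -> Omega -> C.
Hypothesis G_countable : countable [set: G].
Hypothesis a_measurable : forall x y : G, borel_measurable (a x y).
Hypothesis a_hermitian : forall (x y : G) (w : Omega), a x y w = (a y x w)^*%C.
Hypothesis a_invariant : forall (z : G) (F : {fset G})
        (E : set (prod_topology (fun _ : F * F => R[i]))),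
      <<s @open (prod_topology (fun _ : F * F => R[i])) >> E ->
      P [set w | E (fun p => a (val p.1) (val p.2) w)] =
      P [set w | E (fun p => a (val p.1 * z)%g (val p.2 * z)%g w)].
Hypothesis a_moment : (\int[P]_w
        ((\esum_(x in [set: G]) (Normc.normc (a x 1%g w))%:E) ^+ 2) < +oo)%E.

Local Notation kern := (G -> G -> C).
Local Notation X := (random_kernel a).

Let complex_measurable_a x y : complex_measurable (fun w => a x y w).
Proof. exact: complex_measurable_borel. Qed.

Let complex_measurable_X u v : complex_measurable (fun w => X w u v).
Proof. exact: complex_measurable_a. Qed.

Lemma esum_sqr_le (r : G -> R) : (forall x, 0 <= r x) ->
  (\esum_(x in [set: G]) (r x ^+ 2)%:E <= (\esum_(x in [set: G]) (r x)%:E) ^+ 2)%E.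
Proof.
move=> r0; set S := (\esum_(x in [set: G]) (r x)%:E)%E.
have S0 : (0 <= S)%E by apply: esum_ge0 => x _; rewrite lee_fin.
have rS x : ((r x)%:E <= S)%E.
  by apply: esum_ge; exists [set x]; [split | rewrite fsbig_set1].
rewrite expe2; move: S0 rS; case SE : S => [s| |] // S0 rS; last by rewrite mulyy leey.
rewrite -{2}SE; apply: (@le_trans _ _ (\esum_(x in [set: G]) (s%:E * (r x)%:E))%E).
  apply: le_esum => x _; rewrite -EFinM lee_fin expr2 ler_wpM2r//.
  by rewrite -lee_fin rS.
by apply: esumZ_le => // x; rewrite lee_fin.
Qed.

(** By hermitian symmetry the row at the identity has the same moduli as the
    column, and a sum of squares is at most the square of the sum. *)
Lemma second_moment :
  (\esum_(y in [set: G]) \int[P]_w (normc (a 1%g y w) ^+ 2)%:E < +oo)%E.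
Proof.
have ms : measurable_fun [set: Omega]
    (fun w => (\esum_(x in [set: G]) (normc (a x 1%g w))%:E)%E).
  apply: measurable_esum => // [x|x w]; last by rewrite lee_fin normc_ge0.
  apply/measurable_EFinP.
  have -> : (fun w => normc (a x 1%g w)) = (fun w => Num.sqrt (normc (a x 1%g w) ^+ 2)).
    by apply/funext => w; rewrite sqrtr_sqr ger0_norm// normc_ge0.
  apply: measurableT_comp; last exact: complex_measurable_normc2.
  by apply: continuous_measurable_fun; exact: sqrt_continuous.
rewrite -integral_esum//; last 2 first.
- by move=> y; exact: complex_measurable_enormc2.
- by move=> y w; rewrite lee_fin sqr_ge0.
apply: le_lt_trans a_moment; apply: ge0_le_integral => //.
- by move=> w _; apply: esum_ge0 => y _; rewrite lee_fin sqr_ge0.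
- apply: measurable_esum => // [y|y w]; first exact: complex_measurable_enormc2.
  by rewrite lee_fin sqr_ge0.
- by under eq_fun do rewrite expe2; exact: emeasurable_funM.
move=> w _; apply: le_trans (esum_sqr_le _); last by move=> x; exact: normc_ge0.
by apply: le_esum => y _; rewrite a_hermitian normc_conj.
Qed.

Lemma mulgV_bij (x : G) : bijective (fun y : G => x * y^-1)%g.
Proof. by exists (fun y => y^-1 * x)%g => y; rewrite invgM invgK ?mulgVK ?mulKg ?mulVKg. Qed.

(** Translating by y sends the entry (1, x y^-1) to (y, x), and y |-> x y^-1 is a
    bijection of G. *)
Lemma mass_transport (D : kern -> G -> G -> C) x :
  (forall y u, complex_measurable (fun k : kernel_space R G => D k y u)) ->
  (forall z k y u, D k (y * z)%g (u * z)%g = D (translate z k) y u) ->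
  (\int[P]_w sqnorm (fun y => D (X w) y x) =
   \int[P]_w \esum_(u in [set: G]) (normc (D (X w) 1%g u) ^+ 2)%:E)%E.
Proof.
move=> mD Dtr.
have mX := measurable_random_kernel a_measurable.
have mDX y u : complex_measurable (fun w => D (X w) y u) by exact: (complex_measurable_comp mX (mD y u)).
rewrite [LHS]integral_esum//; last 2 first.
- by move=> y; exact: complex_measurable_enormc2.
- by move=> y w; rewrite lee_fin sqr_ge0.
rewrite [RHS]integral_esum//; last 2 first.
- by move=> y; exact: complex_measurable_enormc2.
- by move=> y w; rewrite lee_fin sqr_ge0.
rewrite [RHS](@reindex_esum R G G [set: G] [set: G] (fun y => x * y^-1)%g); last first.
  by rewrite setTT_bijective; exact: mulgV_bij.
apply: eq_esum => y _.
rewrite (stationary_integral a_measurable a_invariant y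
  (h := fun k => (normc (D k 1%g (x * y^-1)%g) ^+ 2)%:E)).
- by apply: eq_integral => w _; rewrite -Dtr mul1g mulgVK.
- exact: complex_measurable_enormc2.
- by move=> k; rewrite lee_fin sqr_ge0.
Qed.

Lemma integral_fin_ae (f : Omega -> \bar R) : measurable_fun [set: Omega] f ->
  (forall w, (0 <= f w)%E) -> (\int[P]_w f w < +oo)%E -> {ae P, forall w, (f w < +oo)%E}.
Proof.
move=> mf f0 fi.
have intf : P.-integrable [set: Omega] f.
  apply/integrableP; split => //; apply: le_lt_trans fi.
  by under eq_integral do rewrite gee0_abs//.
have := integrable_ae measurableT intf; apply: filterS => w /(_ I).
by rewrite ge0_fin_numE.
Qed.

(** The mean squared norm of any column is that of the row at the identity. *)
Lemma columns_square_summable x :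
  {ae P, forall w, square_summable (fun y => a y x w)}.
Proof.
apply: integral_fin_ae.
- by apply: measurable_sqnorm => [|y]; [exact: G_countable | exact: complex_measurable_a].
- by move=> w; exact: sqnorm_ge0.
rewrite (@mass_transport (fun k => k))//; last exact: complex_measurable_coord.
rewrite integral_esum//; last 2 first.
- by move=> y; exact: (complex_measurable_enormc2 (complex_measurable_a 1%g y)).
- by move=> y w; rewrite lee_fin sqr_ge0.
exact: second_moment.
Qed.

(** The kernel of A - T. *)
Definition remainder (K : {fset G}) (m : R) (k : kern) : kern :=
  fun x y => k x y - band K m k x y.

Lemma complex_measurable_band d' (T : measurableType d') (kappa : T -> kern) K (m : R) x y :
  0 <= m -> (forall u v, complex_measurable (fun w => kappa w u v)) ->
  complex_measurable (fun w => band K m (kappa w) x y).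
Proof.
move=> m0 hk; rewrite /band; case: (_ \in K); last exact: complex_measurable_cst.
exact: complex_measurable_trunc.
Qed.

Lemma complex_measurable_remainder d' (T : measurableType d') (kappa : T -> kern) K (m : R) x y :
  0 <= m -> (forall u v, complex_measurable (fun w => kappa w u v)) ->
  complex_measurable (fun w => remainder K m (kappa w) x y).
Proof. by move=> m0 hk; apply: complex_measurableB => //; exact: complex_measurable_band. Qed.

(** Dominated convergence: the truncation leaves f w unchanged once n >= |f w|. *)
Lemma truncation_tail (f : Omega -> C) : complex_measurable f ->
  (\int[P]_w (normc (f w) ^+ 2)%:E < +oo)%E ->
  forall e : R, 0 < e -> exists N : nat, forall n, (N <= n)%N ->
    (\int[P]_w (normc (f w - trunc n%:R (f w)) ^+ 2)%:E <= e%:E)%E.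
Proof.
move=> mf fi e e0.
pose u (n : nat) w := (normc (f w - trunc n%:R (f w)) ^+ 2)%:E.
have mu n : measurable_fun [set: Omega] (u n).
  by apply: complex_measurable_enormc2; apply: complex_measurableB => //; exact: complex_measurable_trunc.
have mg : measurable_fun [set: Omega] (fun w => (normc (f w) ^+ 2)%:E).
  exact: complex_measurable_enormc2.
have lim0 : {ae P, forall w, [set: Omega] w -> u ^~ w @ \oo --> cst 0%E w}.
  apply: aeW => w _; apply: cvg_near_cst; exists (Num.bound (normc (f w))) => // n /= wn.
  have wle : normc (f w) <= n%:R.
    by rewrite (le_trans (ltW (archi_boundP (normc_ge0 _))))// ler_nat.
  by rewrite /u /trunc wle subrr normc0 expr0n.
have intg : P.-integrable [set: Omega] (fun w => (normc (f w) ^+ 2)%:E).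
  apply/integrableP; split => //; apply: le_lt_trans fi.
  by under eq_integral do rewrite gee0_abs ?lee_fin ?sqr_ge0//.
have dom : {ae P, forall w, forall n, [set: Omega] w -> (`|u n w| <= (normc (f w) ^+ 2)%:E)%E}.
  apply: aeW => w n _; rewrite gee0_abs ?lee_fin ?sqr_ge0// /trunc.
  by case: ifP => _; rewrite ?subr0// subrr normc0 expr0n sqr_ge0.
have [_ _] := dominated_convergence measurableT mu (measurable_cst _) lim0 intg dom.
rewrite integral0 => h.
have /h[N _ hN] : nbhs (0%E : \bar R) [set y | (y < e%:E)%E].
  by apply: open_nbhs_nbhs; split; [exact: open_ereal_lt_ereal | rewrite /= lte_fin].
exists N => n Nn; apply: ltW; exact: (hN n Nn).
Qed.

Lemma sum_eventually_small (s : seq G) (u : nat -> G -> \bar R) :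
  (forall y (e : R), 0 < e -> exists N, forall n, (N <= n)%N -> (u n y <= e%:E)%E) ->
  forall e : R, 0 < e -> exists N, forall n, (N <= n)%N -> (\sum_(y <- s) u n y <= e%:E)%E.
Proof.
move=> hu; elim: s => [|y s IH] e e0.
  by exists 0%N => n _; rewrite big_nil lee_fin ltW.
have [|N hN] := hu y (e / 2); first lra.
have [|M hM] := IH (e / 2); first lra.
exists (maxn N M) => n; rewrite geq_max => /andP[Nn Mn]; rewrite big_cons.
have -> : e = e / 2 + e / 2 by lra.
by rewrite EFinD leeD// ?hN// hM.
Qed.

(** K is chosen first, so that the entries outside it have small total second
    moment; then m is chosen for the finitely many entries in K. *)
Lemma remainder_small (e : R) : 0 < e -> exists K : {fset G}, exists m : R,
  [/\ 0 <= m, (forall h, h \in K -> (h^-1)%g \in K) &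
   (\int[P]_w sqnorm (remainder K m (X w) 1%g) <= e%:E)%E].
Proof.
move=> e0; pose g y := (\int[P]_w (normc (a 1%g y w) ^+ 2)%:E)%E.
have g0 y : (0 <= g y)%E by apply: integral_ge0 => w _; rewrite lee_fin sqr_ge0.
have gfin : \esum_(y in [set: G]) g y \is a fin_num.
  by rewrite ge0_fin_numE ?second_moment//; apply: esum_ge0.
have glt y : (g y < +oo)%E.
  apply: le_lt_trans second_moment.
  by apply: esum_ge; exists [set y]; [split | rewrite fsbig_set1].
set s := fine (\esum_(y in [set: G]) g y).
have sE : (\esum_(y in [set: G]) g y = s%:E)%E by rewrite fineK.
have [K0 hK0] : exists K0 : {fset G}, (s%:E - (e / 2)%:E < \sum_(y <- K0) g y)%E.
  have : (s%:E - (e / 2)%:E < \esum_(y in [set: G]) g y)%E.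
    by rewrite sE -EFinB lte_fin; lra.
  move=> /ereal_sup_gt[_ [Y /fsets_fset[A ->] <-]].
  by rewrite fsbig_finite//= set_fsetK => hA; exists A.
pose K := (K0 `|` [fset (h^-1)%g | h in K0])%fset.
have Ksym h : h \in K -> (h^-1)%g \in K.
  rewrite /K !inE => /orP[hK|/imfsetP[u /= uK ->]].
    by apply/orP; right; apply/imfsetP; exists h.
  by rewrite invgK uK.
pose u (n : nat) y := (\int[P]_w (normc (a 1%g y w - trunc n%:R (a 1%g y w)) ^+ 2)%:E)%E.
have [|N hN] := @sum_eventually_small K u _ (e / 2) ltac:(lra).
  by move=> y r r0; exact: (truncation_tail (complex_measurable_a 1%g y) (glt y) r0).
have {}hN := hN N (leqnn N).
exists K; exists N%:R; split => //.
rewrite integral_esum//; last 2 first.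
- by move=> y; apply: complex_measurable_enormc2; exact: complex_measurable_remainder.
- by move=> y w; rewrite lee_fin sqr_ge0.
pose h1 y := if y \in K then u N y else 0%E.
pose h2 y := if y \in K then 0%E else g y.
pose h3 y := if y \in K then g y else 0%E.
have u0 y : (0 <= u N y)%E by apply: integral_ge0 => w _; rewrite lee_fin sqr_ge0.
have h10 y : (0 <= h1 y)%E by rewrite /h1; case: ifP.
have h20 y : (0 <= h2 y)%E by rewrite /h2; case: ifP.
have h30 y : (0 <= h3 y)%E by rewrite /h3; case: ifP.
have -> : (\esum_(y in [set: G]) \int[P]_w (normc (remainder K N%:R (X w) 1%g y) ^+ 2)%:E =
   \esum_(y in [set: G]) (h1 y + h2 y))%E.
  apply: eq_esum => y _; rewrite /h1 /h2 /remainder /band invg1 mulg1; case: ifP => yK.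
    by rewrite adde0.
  by rewrite add0e; apply: eq_integral => w _; rewrite subr0.
rewrite esumD; [|by move=> y _..].
have -> : (\esum_(y in [set: G]) h1 y = \sum_(y <- K) u N y)%E.
  rewrite (@esum_fin_support _ _ _ K) //.
    by apply: eq_big_seq => y yK; rewrite /h1 yK.
  by move=> y; rewrite /h1 => /negbTE ->.
have h3E : (\esum_(y in [set: G]) h3 y = \sum_(y <- K) g y)%E.
  rewrite (@esum_fin_support _ _ _ K) //.
    by apply: eq_big_seq => y yK; rewrite /h3 yK.
  by move=> y; rewrite /h3 => /negbTE ->.
have h23 : (\esum_(y in [set: G]) h2 y + \sum_(y <- K) g y = s%:E)%E.
  rewrite -h3E -esumD; [|by move=> y _..].
  rewrite -sE; apply: eq_esum => y _; rewrite /h2 /h3; case: ifP => _; by rewrite ?adde0 ?add0e.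
have K0K : (\sum_(y <- K0) g y <= \sum_(y <- K) g y)%E.
  rewrite -h3E; apply: le_trans (@esum_ge_fset _ _ h3 K0 h30).
  rewrite le_eqVlt; apply/orP; left; apply/eqP; apply: eq_big_seq => y yK0.
  by rewrite /h3 /K inE yK0.
have tail : (\esum_(y in [set: G]) h2 y <= (e / 2)%:E)%E.
  have := lt_le_trans hK0 K0K; move: h23.
  have : (0 <= \sum_(y <- K) g y)%E by apply: sume_ge0.
  have : (0 <= \esum_(y in [set: G]) h2 y)%E by apply: esum_ge0.
  case: (\esum_(y in [set: G]) h2 y)%E => [r1| |] //; case: (\sum_(y <- K) g y)%E => [r2| |] //.
  by rewrite -EFinD -EFinB !lte_fin !lee_fin => _ _ [<-]; lra.
have -> : e = e / 2 + e / 2 by lra.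
by rewrite EFinD leeD.
Qed.

(** Transport to the identity, then the transposed bound for each realization:
    the operator norm of the approximate resolvent is bounded by 2 / |t| whatever
    the truncation. *)
Lemma remainder_action_le (K : {fset G}) (m : R) (m0 : 0 <= m) (s t : R) n x :
  (forall h, h \in K -> (h^-1)%g \in K) -> t != 0 ->
  (\int[P]_w sqnorm (kernel_action (remainder K m (X w))
      (band_resolvent K m0 s t (X w) (delta x) n)) <=
   ((2 / `|t|) ^+ 2)%:E * \int[P]_w sqnorm (remainder K m (X w) 1%g))%E.
Proof.
move=> Ksym t0.
pose D (k : kern) y u := kernel_action (remainder K m k) (band_resolvent K m0 s t k (delta u) n) y.
have mid : forall u v, complex_measurable (fun k : kernel_space R G => k u v) by exact: complex_measurable_coord.
have mX := measurable_random_kernel a_measurable.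
have mD y u : complex_measurable (fun k : kernel_space R G => D k y u).
  have [A hA] := band_resolvent_support K m0 s t u n.
  have -> : (fun k : kernel_space R G => D k y u) = (fun k => \sum_(v <- A)
      remainder K m k y v * band_resolvent K m0 s t k (delta u) n v).
    by apply/funext => k; apply: kernel_action_fset; exact: hA.
  apply: complex_measurable_sum => v; apply: complex_measurableM; first exact: (@complex_measurable_remainder _ (kernel_space R G) id).
  exact: (@complex_measurable_band_resolvent _ _ _ (kernel_space R G) id).
have Dtr z k y u : D k (y * z)%g (u * z)%g = D (translate z k) y u.
  rewrite /D /kernel_action (reindex_fsbigT (fun v : G => v * z)%g _ (mulgr_bij z)).
  apply: eq_fsbigr => v _; rewrite band_resolvent_translate; congr (_ * _).
  by rewrite /remainder band_translate.
apply: (@le_trans _ _ (\int[P]_w \esum_(u in [set: G]) (normc (D (X w) 1%g u) ^+ 2)%:E)%E).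
  by rewrite -(mass_transport x mD Dtr).
have t1 : 0 < 2 / `|t| by rewrite divr_gt0// normr_gt0.
have mDX y u : complex_measurable (fun w => D (X w) y u) by exact: (complex_measurable_comp mX (mD y u)).
have mrem : measurable_fun [set: Omega] (fun w => sqnorm (remainder K m (X w) 1%g)).
  by apply: measurable_sqnorm => // y; exact: complex_measurable_remainder.
rewrite -ge0_integralZl_EFin//; last by move=> w _; exact: sqnorm_ge0.
apply: ge0_le_integral => //.
- by move=> w _; apply: esum_ge0 => y _; rewrite lee_fin sqr_ge0.
- apply: measurable_esum => // [y|y w]; first exact: complex_measurable_enormc2.
  by rewrite lee_fin sqr_ge0.
- exact: measurable_funeM.
move=> w _; apply: (@transpose_bound _ _ (fun f => band_resolvent K m0 s t (X w) f n)
  (2 / `|t|) (remainder K m (X w) 1%g)) => //.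
- exact: band_resolvent_linear.
- by move=> f; exact: D0_band_resolvent.
- by move=> f; apply: band_resolvent_le => // u v; exact: a_hermitian.
Qed.

(** The error splits into the residual of the polynomial, of norm at most
    rate ^ n for every realization, and the remainder of the kernel applied to
    the approximate resolvent. *)
Lemma approximate_resolvent (z : C) x (e : R) : complex.Im z != 0 -> 0 < e ->
  exists v : Omega -> H, [/\ exists A : {fset G}, forall w y, y \notin A -> v w y = 0,
    forall y, complex_measurable (fun w => v w y) &
    (\int[P]_w sqnorm (fun y => (z * v w y - kernel_action (fun x y => a x y w) (v w) y
       - delta x y)%R) <= e%:E)%E].
Proof.
case: z => s t /= t0 e0.
pose M := (2 / `|t|) ^+ 2; have M0 : 0 < M by rewrite exprn_gt0// divr_gt0// normr_gt0.
have [|K [m [m0 Ksym hr]]] := remainder_small (e := e / 4 / M); first by rewrite !divr_gt0.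
have [n hn] : exists n, contraction_rate t (shifted_bound K m s) ^+ n <= Num.min 1 (e / 4).
  have /andP[q0 q1] := contraction_rate_lt1 K m s t0.
  have qn : `|contraction_rate t (shifted_bound K m s)| < 1 by rewrite ger0_norm.
  have r0 : 0 < Num.min 1 (e / 4) by rewrite lt_min ltr01 divr_gt0.
  have /cvgrPdist_le/(_ _ r0)[n _ hn] := cvg_expr qn.
  exists n; have := hn n (leqnn n); rewrite sub0r normrN ger0_norm ?exprn_ge0//.
have mXc u v : complex_measurable (fun w => X w u v) by exact: complex_measurable_a.
have [A hA] := band_resolvent_support K m0 s t x n.
exists (fun w => band_resolvent K m0 s t (X w) (delta x) n); split.
- by exists A => w y; exact: hA.
- by move=> y; exact: complex_measurable_band_resolvent.
pose v w := band_resolvent K m0 s t (X w) (delta x) n.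
pose f2 w := kernel_action (remainder K m (X w)) (v w).
have mf2 : measurable_fun [set: Omega] (fun w => sqnorm (f2 w)).
  apply: measurable_sqnorm => // y.
  under eq_fun do rewrite /f2 (kernel_action_fset _ _ (hA _)).
  by apply: complex_measurable_sum => u; apply: complex_measurableM; [exact: complex_measurable_remainder | exact: complex_measurable_band_resolvent].
apply: (@le_trans _ _ (\int[P]_w ((e / 2)%:E + 2%:E * sqnorm (f2 w)))%E).
  apply: ge0_le_integral => //.
  - by move=> w _; exact: sqnorm_ge0.
  - apply: measurable_sqnorm => // y; apply: complex_measurableB; last exact: complex_measurable_cst.
    apply: complex_measurableB; first by apply: complex_measurableM; [exact: complex_measurable_cst | exact: complex_measurable_band_resolvent].
    under eq_fun do rewrite (kernel_action_fset _ _ (hA _)).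
    by apply: complex_measurable_sum => u; apply: complex_measurableM; [exact: complex_measurable_a | exact: complex_measurable_band_resolvent].
  - by apply: emeasurable_funD => //; exact: measurable_funeM.
  move=> w _.
  pose f1 : H := (s +i* t)%C *: v w - bandop K m0 (X w) (v w) - delta x.
  have f1le : (sqnorm f1 <= (e / 4)%:E)%E.
    rewrite (sqr_l2norm (l2_square_summable f1)) lee_fin.
    have := band_resolvent_error m0 Ksym s t0 (fun u v => a_hermitian u v w) n (D0_delta R x).
    rewrite l2norm_delta mulr1 -/(v w) -/f1 => h1.
    have := le_trans h1 hn; rewrite le_min => /andP[h2 h3].
    by rewrite expr2 (le_trans _ h3)// ler_piMl ?l2norm_ge0.
  have split_error (u : H) : (forall y, y \notin A -> u y = 0) ->
      (fun y => (s +i* t)%C * u y - kernel_action (fun x0 y0 => a x0 y0 w) u y - delta x y)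
      = (l2fun ((s +i* t)%C *: u - bandop K m0 (X w) u - delta x) : G -> C)
        + (-1) *: kernel_action (remainder K m (X w)) u.
    move=> uA; apply/funext => y.
    rewrite -[RHS]/(((s +i* t)%C * u y - bandop K m0 (X w) u y - delta x y)
      + (-1) * kernel_action (remainder K m (X w)) u y) bandop_kernel.
    rewrite !(kernel_action_fset _ _ uA) mulN1r.
    have -> : \sum_(y0 <- A) remainder K m (X w) y y0 * u y0 =
       \sum_(y0 <- A) a y y0 w * u y0 - \sum_(y0 <- A) band K m (X w) y y0 * u y0.
      by rewrite -sumrB; apply: eq_bigr => y0 _; rewrite -mulrBl.
    ring.
  rewrite (split_error (v w)); last by move=> y; exact: hA.
  apply: (le_trans (@sqnormD_le _ _ 1 _ _ ltr01)).
  have -> : (e / 2)%:E = (2%:E * (e / 4)%:E)%E by rewrite -EFinM; congr EFin; lra.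
  rewrite invr1; have -> : 1 + 1 = 2 :> R by [].
  apply: leeD; first by rewrite lee_pmul2l.
  rewrite lee_pmul2l//; apply: le_trans (sqnormZ_le _ _) _.
  by rewrite normc_opp normc1 expr1n mul1e.
rewrite ge0_integralD//; last 3 first.
- by move=> w _; rewrite lee_fin divr_ge0// ltW.
- by move=> w _; rewrite mule_ge0// sqnorm_ge0.
- exact: measurable_funeM.
rewrite integral_cst// [X in (_ * X + _)%E](_ : _ = 1%E); last exact: probability_setT.
rewrite mule1 ge0_integralZl_EFin//; last first.
  by move=> w _; exact: sqnorm_ge0.
(* The factors 2 come from |f1 + f2|^2 <= 2 |f1|^2 + 2 |f2|^2. *)
have eE : e = e / 2 + 2 * (M * (e / 4 / M)).
  by rewrite [M * _]mulrC divfK ?gt_eqF//; lra.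
rewrite [X in (_ <= X%:E)%E]eE (EFinD (e / 2)); apply: leeD; first exact: lexx.
rewrite (EFinM 2) lee_pmul2l//.
apply: (le_trans (remainder_action_le m0 s n x Ksym t0)).
by rewrite (EFinM M) lee_pmul2l.
Qed.

End MeanSquare.

(** * Almost sure essential self-adjointness and measurable resolvents *)

Section AlmostSure.
Variables (R : realType) (d : measure_display) (Omega : measurableType d)
  (P : probability Omega R).

Lemma ae_countable (I : choiceType) (Q : I -> Omega -> Prop) : countable [set: I] ->
  (forall i, {ae P, forall w, Q i w}) -> {ae P, forall w, forall i, Q i w}.
Proof.
move=> Ic hQ; have [e [j [ej _]]] := countable_enum Ic.
have : {ae P, forall w, forall n, if e n is Some i then Q i w else True}.
  apply: ae_foralln => n; case: (e n) => [i|]; first exact: hQ.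
  by apply: aeW.
by apply: filterS => w h i; have := h (j i); rewrite ej.
Qed.

Lemma ae_event (Q : Omega -> Prop) : {ae P, forall w, Q w} ->
  exists E : set Omega, [/\ measurable E, P E = 1%E & forall w, E w -> Q w].
Proof.
move=> [N [mN N0 QN]]; exists (~` N); split; first exact: measurableC.
  by rewrite probability_setC// N0 sube0.
by move=> w Nw; apply: contrapT => nQ; apply: Nw; exact: QN.
Qed.

(** The expectations have a finite sum, so almost every series of values
    converges and its terms tend to 0. *)
Lemma ae_summable_vanish (f : nat -> Omega -> \bar R) :
  (forall n, measurable_fun [set: Omega] (f n)) -> (forall n w, (0 <= f n w)%E) ->
  (forall n, (\int[P]_w f n w <= (1 / (2 ^ n.+1)%:R)%:E)%E) ->
  {ae P, forall w, forall e : R, 0 < e -> exists N, forall n, (N <= n)%N -> (f n w <= e%:E)%E}.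
Proof.
move=> mf f0 fle.
have : {ae P, forall w, (\sum_(n <oo) f n w < +oo)%E}.
  apply: integral_fin_ae.
  - by apply: ge0_emeasurable_sum => // k w _ _.
  - by move=> w; apply: nneseries_ge0 => n _ _.
  rewrite integral_nneseries//.
  apply: (@le_lt_trans _ _ 1%E); last by rewrite ltry.
  apply: le_trans (@epsilon_trick0 R 1 xpredT ler01).
  by apply: lee_nneseries => *; [apply: integral_ge0 | exact: fle].
apply: filterS => w fin e e0.
have tl := nneseries_tail_cvg fin (fun n _ => f0 n w).
have /tl[N _ hN] : nbhs (0%E : \bar R) [set y | (y < e%:E)%E].
  by apply: open_nbhs_nbhs; split; [exact: open_ereal_lt_ereal | rewrite /= lte_fin].
exists N => n Nn; apply: le_trans (ltW (hN n Nn)).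
rewrite (nneseries_split n 1)//.
by rewrite addn1 big_nat1 leeDl// nneseries_ge0.
Qed.

End AlmostSure.

Section RandomOperator.
Variables (R : realType) (G : groupType).
Local Notation C := R[i].
Local Notation H := (l2 R G).
Local Notation "''|' f |" := (l2norm (l2fun f)) (at level 0, f at level 99, format "''|' f |").

Definition gauss_rational (p : rat * rat) : C := (ratr p.1 +i* ratr p.2)%C.

Lemma Im_gauss_rational p : (complex.Im (gauss_rational p) != 0) = (p.2 != 0).
Proof. by rewrite /= fmorph_eq0. Qed.

Lemma gauss_rational_near (z : C) (e : R) : complex.Im z != 0 -> 0 < e ->
  exists p, [/\ normc (z - gauss_rational p) <= e, p.2 != 0 &
    `|complex.Im z| / 2 <= `|complex.Im (gauss_rational p)| ].
Proof.
move=> z0 e0; have y0 : 0 < `|complex.Im z| by rewrite normr_gt0.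
have [|p] := rat_complex_dense z (e := Num.min e (`|complex.Im z| / 2)).
  by rewrite lt_min e0 divr_gt0.
rewrite -/(gauss_rational p) lt_min => /andP[h1 h2].
have h3 : `|complex.Im z| / 2 <= `|complex.Im (gauss_rational p)|.
  have := normc_Im (z - gauss_rational p); rewrite Im_add Im_opp => h.
  have := ler_distD (complex.Im (gauss_rational p)) (complex.Im z) 0; rewrite !subr0; lra.
exists p; split; [exact: ltW| |exact: h3].
by rewrite -Im_gauss_rational -normr_gt0 (lt_le_trans _ h3)// divr_gt0.
Qed.

(** Gaussian rational parameters and point masses: the countably many conditions
    that a full event can impose at once. *)
Lemma approx_all_of_gauss (k : G -> G -> C) :
  (forall y, square_summable (k ^~ y)) -> (forall x y, k x y = (k y x)^*%C) ->
  (forall p x, p.2 != 0 -> approx_range (kernel_operator k) (gauss_rational p) (delta x)) ->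
  forall z, complex.Im z != 0 -> forall xi, approx_range (kernel_operator k) z xi.
Proof.
move=> kss kherm hk z z0; have [T0 lT _] := kernel_operator_is_operator k.
apply: approx_range_near => //; first exact: symmetric_kernel_operator.
move=> e e0; have [p [h1 h2 _]] := gauss_rational_near z0 e0.
exists (gauss_rational p); split => //; first by rewrite Im_gauss_rational.
by apply: approx_range_all => // x; exact: hk.
Qed.

Lemma resolvent_id z (xi : H) : complex.Im z != 0 ->
  resolvent (@id_operator R G) z xi = (z - 1)^-1 *: xi.
Proof.
move=> z0; have z1 : z - 1 != 0.
  by apply: contraNneq z0 => /eqP; rewrite subr_eq0 => /eqP ->.
have Tid : @id_operator R G ((z - 1)^-1 *: xi, (z - 1)^-1 *: xi) by [].
rewrite [RHS](resolvent_uniq (full_symmetric_id R G) z0 Tid); congr resolvent.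
by rewrite -[X in _ - X]scale1r -scalerBl scalerA divff// scale1r.
Qed.

Hypothesis G_countable : countable [set: G].
Variables (d : measure_display) (Omega : measurableType d).
Variable A : Omega -> set (H * H).
Hypothesis A_full : forall w, full_symmetric (A w).

(** Finite truncations of xi and Gaussian rational parameters tending to z exhibit
    every coordinate as an iterated pointwise limit of measurable functions; the
    resolvent is Lipschitz in both arguments. *)
Lemma resolvent_measurable :
  (forall p x y, p.2 != 0 ->
     complex_measurable (fun w => resolvent (A w) (gauss_rational p) (delta x) y)) ->
  forall z, complex.Im z != 0 -> strongly_measurable (fun w => resolvent (A w) z).
Proof.
move=> hmeas z z0; split; first by move=> w; exact: resolvent_bounded.
move=> xi; apply: l2_borel_measurable => // y.
have /boolp.choice[p hp] : forall n : nat, exists p : rat * rat,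
    [/\ normc (z - gauss_rational p) <= n.+1%:R^-1, p.2 != 0 &
    `|complex.Im z| / 2 <= `|complex.Im (gauss_rational p)| ].
  by move=> n; apply: gauss_rational_near => //; rewrite invr_gt0.
have /boolp.choice[B hB] : forall n : nat, exists B : {fset G},
    '|xi - l2restrict B xi| <= n.+1%:R^-1.
  by move=> n; apply: l2restrict_approx; rewrite invr_gt0.
have small (e : R) : 0 < e -> exists N, forall n, (N <= n)%N -> n.+1%:R^-1 <= e.
  move=> e0; have := @near_infty_natSinv_lt R (PosNum e0) => -[N _ hN].
  by exists N => n Nn; apply/ltW/hN.
apply: (@complex_measurable_lim _ _ _ (fun n w => resolvent (A w) (gauss_rational (p n)) xi y)); last first.
  move=> w e e0; have y0 : 0 < `|complex.Im z| by rewrite normr_gt0.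
  have k0 : 0 < 1 + '|resolvent (A w) z xi| by rewrite ltr_pwDl// l2norm_ge0.
  have [|N hN] := small (e * (`|complex.Im z| / 2) / (1 + '|resolvent (A w) z xi|)).
    by rewrite !divr_gt0// mulr_gt0// divr_gt0.
  exists N => n Nn; have [h1 h2 h3] := hp n.
  have w0 : complex.Im (gauss_rational (p n)) != 0 by rewrite Im_gauss_rational.
  rewrite -l2BE (le_trans (normc_coord_le _ _))//.
  rewrite (le_trans (resolvent_lipschitz xi (A_full w) z0 w0))//.
  have wp : 0 < `|complex.Im (gauss_rational (p n))| by rewrite normr_gt0.
  rewrite ler_pdivrMl//; have := le_trans h1 (hN n Nn).
  rewrite ler_pdivlMr// => h4.
  have := l2norm_ge0 (resolvent (A w) z xi); have := normc_ge0 (z - gauss_rational (p n)).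
  nra.
move=> n; have [_ p0 _] := hp n.
have w0 : complex.Im (gauss_rational (p n)) != 0 by rewrite Im_gauss_rational.
apply: (@complex_measurable_lim _ _ _ (fun m w => resolvent (A w) (gauss_rational (p n)) (l2restrict (B m) xi) y)).
  move=> m.
  have -> : (fun w => resolvent (A w) (gauss_rational (p n)) (l2restrict (B m) xi) y) =
     (fun w => \sum_(x <- B m) xi x * resolvent (A w) (gauss_rational (p n)) (delta x) y).
    apply/funext => w; rewrite l2restrictE.
    rewrite (linear_combination _ _ _ (resolvent_linear (A_full w) w0)) l2sumE.
    by apply: eq_bigr => x _; rewrite l2ZE.
  by apply: complex_measurable_sum => x; apply: complex_measurableM; [exact: complex_measurable_cst | exact: hmeas].
move=> w e e0; have wp : 0 < `|complex.Im (gauss_rational (p n))| by rewrite normr_gt0.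
have [|N hN] := small (e * `|complex.Im (gauss_rational (p n))|); first by rewrite mulr_gt0.
exists N => m Nm; rewrite -l2BE (le_trans (normc_coord_le _ _))//.
rewrite addrC -scaleN1r -(resolvent_linear (A_full w) w0).
rewrite (le_trans (resolvent_le _ (A_full w) w0))// ler_pdivrMl// mulrC.
rewrite scaleN1r addrC norml2_distC.
exact: le_trans (hB m) (hN m Nm).
Qed.

End RandomOperator.

Theorem proposition3p3 (R : realType) (G : groupType)
    (d : measure_display) (Omega : measurableType d) (P : probability Omega R)
    (a : G -> G -> Omega -> R[i])
    (G_countable : countable [set: G])
    (a_measurable : forall x y : G, borel_measurable (a x y))
    (a_hermitian : forall (x y : G) (w : Omega), a x y w = (a y x w)^*%C)
    (a_invariant : forall (z : G) (F : {fset G})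
        (E : set (prod_topology (fun _ : F * F => R[i]))),
      <<s @open (prod_topology (fun _ : F * F => R[i])) >> E ->
      P [set w | E (fun p => a (val p.1) (val p.2) w)] =
      P [set w | E (fun p => a (val p.1 * z)%g (val p.2 * z)%g w)])
    (a_moment : (\int[P]_w
        ((\esum_(x in [set: G]) (Normc.normc (a x 1%g w))%:E) ^+ 2) < +oo)%E) :
  let Atilde (w : Omega) : set (l2 R G * l2 R G) :=
    kernel_operator (fun x y => a x y w) in
  exists Omega1 : set Omega,
    [/\ measurable Omega1,
        P Omega1 = 1%E,
        forall w, Omega1 w ->
          (forall f, D0 f ->
             square_summable (kernel_action (fun x y => a x y w) f)) /\
          essentially_self_adjoint (Atilde w) &
        let A (w : Omega) : set (l2 R G * l2 R G) :=
          if `[< Omega1 w >] then closure (Atilde w)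
          else @id_operator R G in
        forall z : R[i], complex.Im z != 0 ->
          (forall w, resolvent_set (A w) z) /\
          strongly_measurable (fun w => resolvent (A w) z)].
Proof.
move=> Atilde.
pose err z x (v : Omega -> l2 R G) w (y : G) : R[i] :=
  z * v w y - kernel_action (fun x y => a x y w) (v w) y - delta x y.
have complex_measurable_a x y : complex_measurable (fun w => a x y w) by exact: complex_measurable_borel.
have /boolp.choice[v hv] : forall i : (rat * rat) * G * nat,
    exists v : Omega -> l2 R G, i.1.1.2 != 0 ->
    [/\ exists F : {fset G}, forall w y, y \notin F -> v w y = 0,
      forall y, complex_measurable (fun w => v w y) &
      (\int[P]_w sqnorm (err (gauss_rational R i.1.1) i.1.2 v w) <= (1 / (2 ^ i.2.+1)%:R)%:E)%E].
  move=> [[p x] n] /=; have [p0|p0] := boolP (p.2 != 0); last first.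
    by exists (fun=> 0) => h; case/negP: p0.
  have [||v [h1 h2 h3]] := @approximate_resolvent R G d Omega P a G_countable
      a_measurable a_hermitian a_invariant a_moment (gauss_rational R p) x (1 / (2 ^ n.+1)%:R).
  - by rewrite Im_gauss_rational.
  - by rewrite divr_gt0// ltr0n expn_gt0.
  by exists v => _; split.
have cols : {ae P, forall w, forall x, square_summable (fun y => a y x w)}.
  by apply: ae_countable => // x; exact: columns_square_summable.
pose conv (p : rat * rat) x w := p.2 != 0 -> forall e : R, 0 < e ->
  exists N, forall n, (N <= n)%N ->
    (sqnorm (err (gauss_rational R p) x (v (p, x, n)) w) <= e%:E)%E.
have conv_ae : {ae P, forall w, forall p x, conv p x w}.
  apply: ae_countable => [|p]; first exact: countableP.
  apply: ae_countable => // x.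
  have [p0|p0] := boolP (p.2 != 0); last by apply: aeW => w h; case/negP: p0.
  have : {ae P, forall w, forall e : R, 0 < e -> exists N, forall n, (N <= n)%N ->
      (sqnorm (err (gauss_rational R p) x (v (p, x, n)) w) <= e%:E)%E}.
    apply: ae_summable_vanish => n.
    - have [[F hF] mv _] := hv (p, x, n) p0.
      apply: measurable_sqnorm => // y; apply: complex_measurableB; last exact: complex_measurable_cst.
      apply: complex_measurableB; first by apply: complex_measurableM; [exact: complex_measurable_cst | exact: mv].
      under eq_fun do rewrite (kernel_action_fset _ _ (hF _)).
      by apply: complex_measurable_sum => u; apply: complex_measurableM => //; exact: mv.
    - by move=> w; exact: sqnorm_ge0.
    - by have [_ _] := hv (p, x, n) p0.
  by apply: filterS => w h _; exact: h.
have [E [mE PE good]] := ae_event (filterI cols conv_ae).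
have kss w : E w -> forall x, square_summable (fun y => a y x w) by move=> /good[].
have Dv p x n w : p.2 != 0 -> D0 (v (p, x, n) w).
  by move=> p0; have [[F hF] _ _] := hv (p, x, n) p0; apply/D0P; exists F; exact: hF.
have approx w p x (e : R) : E w -> p.2 != 0 -> 0 < e -> exists N, forall n, (N <= n)%N ->
    exists2 g, Atilde w (v (p, x, n) w, g) &
      l2norm (l2fun (gauss_rational R p *: v (p, x, n) w - g - delta x)) <= e.
  move=> Ew p0 e0; have [_ /(_ p x p0)] := good w Ew.
  move=> /(_ (e ^+ 2)); rewrite exprn_gt0// => /(_ isT)[N hN].
  exists N => n Nn; have [g [Dg gE]] := kernel_action_ex (kss w Ew) (Dv p x n w p0).
  exists g => //; have := hN n Nn.
  have -> : err (gauss_rational R p) x (v (p, x, n)) w =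
      l2fun (gauss_rational R p *: v (p, x, n) w - g - delta x).
    by apply/funext => y; rewrite /err -gE.
  rewrite (sqr_l2norm (l2_square_summable _)) lee_fin ler_pXn2r// ?nnegrE ?l2norm_ge0// ltW//.
have esa w : E w -> essentially_self_adjoint (Atilde w) /\ full_symmetric (closure (Atilde w)).
  move=> Ew; apply: kernel_essentially_self_adjoint; [exact: kss | by move=> *; exact: a_hermitian|].
  apply: approx_all_of_gauss; [exact: kss | by move=> *; exact: a_hermitian|].
  move=> p x p0 e e0; have [N hN] := approx w p x e Ew p0 e0.
  by have [g Tg le] := hN N (leqnn N); exists (v (p, x, N) w, g).
exists E; split => //.
  move=> w Ew; split; last by case: (esa w Ew).
  by move=> f Df; apply: kernel_action_square_summable => //; exact: kss.
move=> A.
have A_full w : full_symmetric (A w).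
  rewrite /A; case: asboolP => [Ew|_]; [by case: (esa w Ew) | exact: full_symmetric_id].
move=> z z0; split; first by move=> w; exact: full_symmetric_resolvent_set.
apply: resolvent_measurable => // p x y p0.
have w0 : complex.Im (gauss_rational R p) != 0 by rewrite Im_gauss_rational.
(* Off the event the operator is the identity, with resolvent (z - 1)^-1. *)
pose F n w := if `[< E w >] then v (p, x, n) w y
  else (gauss_rational R p - 1)^-1 * delta x y.
apply: (@complex_measurable_lim _ _ _ F) => [n|w e e0].
  apply: complex_measurable_if; [|by have [_ mv _] := hv (p, x, n) p0; exact: mv | exact: complex_measurable_cst].
  apply: (measurable_fun_bool true); rewrite setTI.
  rewrite (_ : _ @^-1` _ = E)//; apply/seteqP; split => w /=; first by move/asboolP.
  by move=> ?; apply/asboolP.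
rewrite /F /A; case: asboolP => Ew; last first.
  exists 0%N => n _; rewrite resolvent_id// l2ZE subrr normc0 ltW//.
have wp : 0 < `|complex.Im (gauss_rational R p)| by rewrite normr_gt0.
have [|N hN] := approx w p x (e * `|complex.Im (gauss_rational R p)|) Ew p0.
  by rewrite mulr_gt0.
have [_ fsA] := esa w Ew.
exists N => n Nn; have [g Tg le] := hN n Nn.
have cTg : closure (Atilde w) (v (p, x, n) w, g) by exact: subset_closure.
rewrite -l2BE (le_trans (normc_coord_le _ _))// (resolvent_uniq fsA w0 cTg).
rewrite addrC -scaleN1r -(resolvent_linear fsA w0) scaleN1r addrC.
by rewrite (le_trans (resolvent_le _ fsA w0))// ler_pdivrMl// mulrC.
Qed.
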